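(* Consider the diffusion strategy with noisy information exchange, with the data model, noise model, standing assumptions and notation given in the context. Then $\mathbb{E}\boldsymbol{z}_i=z$ with $z=-\mathcal{R}_{v,c}^{(u)}(\mathbf{1}_N\otimes w^o)$, and the network error vector satisfies, for all $i\ge 0$, $$\mathbb{E}\widetilde{\boldsymbol{w}}_i=\mathcal{B}\,\mathbb{E}\widetilde{\boldsymbol{w}}_{i-1}-\mathcal{A}_2^{\mathsf T}\mathcal{M}z,\qquad \mathcal{B}=\mathcal{A}_2^{\mathsf T}(I_{NM}-\mathcal{M}\mathcal{R}')\mathcal{A}_1^{\mathsf T}.$$ The matrix $\mathcal{B}$ is stable, i.e. $\rho(\mathcal{B})<1$, whenever $I_{NM}-\mathcal{M}\mathcal{R}'$ is stable, i.e. $\rho(I_{NM}-\mathcal{M}\mathcal{R}')<1$. Consequently, convergence of $\mathbb{E}\widetilde{\boldsymbol{w}}_i$ to a steady-state value is guaranteed if the (positive) step-sizes satisfy $$\mu_k<\frac{2}{\lambda_{\max}(R_k')}\qquad\text{for all }k=1,\dots,N,$$ and under this condition $$\lim_{i\to\infty}\mathbb{E}\widetilde{\boldsymbol{w}}_i=g,\qquad g=-(I_{NM}-\mathcal{B})^{-1}\mathcal{A}_2^{\mathsf T}\mathcal{M}z .$$ If moreover $C$ is doubly stochastic ($C\mathbf{1}_N=\mathbf{1}_N$ and $C^{\mathsf T}\mathbf{1}_N=\mathbf{1}_N$), then a sufficient condition for this convergence is $$\mu_k<\frac{2}{\max_{l\in\mathcal{N}_k}\lambda_{\max}\big(R_{u,l}+R_{v,lk}^{(u)}\big)}\qquad\text{for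 all }k=1,\dots,N.$$
   Context: Notation: $(\cdot)^*$ is conjugate transposition, $\rho(\cdot)$ the spectral radius, $\lambda_{\max}(\cdot)$ the largest eigenvalue of a Hermitian matrix, $\otimes$ the Kronecker product, $\mathbf{1}_N$ the all-ones column vector of length $N$, $\mathrm{col}\{\cdot\}$ vertical stacking, $\mathrm{diag}\{\cdot\}$ a block diagonal matrix. Boldface denotes random quantities. All vectors are complex column vectors, except that the regressors $\boldsymbol{u}_{k,i}$ and the noises $\boldsymbol{v}_{lk,i}^{(u)}$ are $1\times M$ row vectors. Network and data: there is a connected network of $N$ nodes; $\mathcal{N}_k$ is the neighborhood of node $k$ (including $k$ itself). Node $k$ observes, for $i\ge 0$, a scalar $\boldsymbol{d}_k(i)$ and a regressor $\boldsymbol{u}_{k,i}$ with $\boldsymbol{d}_k(i)=\boldsymbol{u}_{k,i}w^o+\boldsymbol{v}_k(i)$, where $w^o\in\mathbb{C}^M$ is a fixed unknown vector. Combination matrices: $A_1=[a_{1,lk}]$, $A_2=[a_{2,lk}]$, $C=[c_{lk}]$ are $N\times N$ matrices with nonnegative entries which vanish when $l\notin\mathcal{N}_k$, and $A_1^{\mathsf T}\mathbf{1}_N=\mathbf{1}_N$, $A_2^{\mathsf T}\mathbf{1}_N=\mathbf{1}_N$, $C\mathbf{1}_N=\mathbf{1}_N$. The step-sizes are $\mu_k>0$. Noisy exchange: node $k$ receives from $l\in\mathcal{N}_k$ the quantities $\boldsymbol{w}_{lk,i-1}=\boldsymbol{w}_{l,i-1}+\boldsymbol{v}_{lk,i-1}^{(w)}$,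 $\boldsymbol{\psi}_{lk,i}=\boldsymbol{\psi}_{l,i}+\boldsymbol{v}_{lk,i}^{(\psi)}$, $\boldsymbol{d}_{lk}(i)=\boldsymbol{d}_l(i)+\boldsymbol{v}_{lk}^{(d)}(i)$, $\boldsymbol{u}_{lk,i}=\boldsymbol{u}_{l,i}+\boldsymbol{v}_{lk,i}^{(u)}$. The diffusion strategy is, for $i\ge0$ and $k=1,\dots,N$, $$\boldsymbol{\phi}_{k,i-1}=\sum_{l\in\mathcal{N}_k}a_{1,lk}\boldsymbol{w}_{lk,i-1},$$ $$\boldsymbol{\psi}_{k,i}=\boldsymbol{\phi}_{k,i-1}+\mu_k\sum_{l\in\mathcal{N}_k}c_{lk}\boldsymbol{u}_{lk,i}^*[\boldsymbol{d}_{lk}(i)-\boldsymbol{u}_{lk,i}\boldsymbol{\phi}_{k,i-1}],$$ $$\boldsymbol{w}_{k,i}=\sum_{l\in\mathcal{N}_k}a_{2,lk}\boldsymbol{\psi}_{lk,i},$$ started from initial estimates $\boldsymbol{w}_{k,-1}$ that are independent of all regression data and noise signals. Statistical assumptions: (1) the regressors $\boldsymbol{u}_{k,i}$ are temporally white and spatially independent (independent over time $i$ and over nodes $k$), zero mean, with covariance $R_{u,k}=\mathbb{E}\boldsymbol{u}_{k,i}^*\boldsymbol{u}_{k,i}\ge 0$. (2) The noises $\boldsymbol{v}_k(i)$, $\boldsymbol{v}_{lk,i-1}^{(w)}$, $\boldsymbol{v}_{lk}^{(d)}(i)$, $\boldsymbol{v}_{lk,i}^{(u)}$, $\boldsymbol{v}_{lk,i}^{(\psi)}$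 are temporally white and spatially independent (independent over time and over nodes/links), zero mean, with (co)variances $\sigma_{v,k}^2$, $R_{v,lk}^{(w)}$, $\sigma_{v,lk}^2$, $R_{v,lk}^{(u)}=\mathbb{E}\boldsymbol{v}_{lk,i}^{(u)*}\boldsymbol{v}_{lk,i}^{(u)}$, $R_{v,lk}^{(\psi)}$ respectively; the link-noise (co)variances $R_{v,lk}^{(w)},\sigma_{v,lk}^2,R_{v,lk}^{(u)},R_{v,lk}^{(\psi)}$ are zero if $l\notin\mathcal{N}_k$ or $l=k$. (3) The regressors, the model noises and the four families of link noises are mutually independent for all time, node and link indices. Network quantities: $\widetilde{\boldsymbol{w}}_{k,i}=w^o-\boldsymbol{w}_{k,i}$, $\widetilde{\boldsymbol{w}}_i=\mathrm{col}\{\widetilde{\boldsymbol{w}}_{1,i},\dots,\widetilde{\boldsymbol{w}}_{N,i}\}$; $\boldsymbol{v}_{lk}(i)=\boldsymbol{v}_l(i)+\boldsymbol{v}_{lk}^{(d)}(i)-\boldsymbol{v}_{lk,i}^{(u)}w^o$ for $l\in\mathcal{N}_k\setminus\{k\}$ and $\boldsymbol{v}_{kk}(i)=\boldsymbol{v}_k(i)$; $\boldsymbol{z}_{k,i}=\sum_{l\in\mathcal{N}_k}c_{lk}\boldsymbol{u}_{lk,i}^*\boldsymbol{v}_{lk}(i)$, $\boldsymbol{z}_i=\mathrm{col}\{\boldsymbol{z}_{1,i},\dots,\boldsymbol{z}_{N,i}\}$; $\mathcal{M}=\mathrm{diag}\{\mu_1I_M,\dots,\mu_NI_M\}$; $\mathcal{A}_1=A_1\otimes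 I_M$, $\mathcal{A}_2=A_2\otimes I_M$; $R_k'=\sum_{l\in\mathcal{N}_k}c_{lk}(R_{u,l}+R_{v,lk}^{(u)})$, $\mathcal{R}'=\mathrm{diag}\{R_1',\dots,R_N'\}$; $\mathcal{R}_{v,c}^{(u)}$ is the $NM\times NM$ matrix whose $(k,l)$-th $M\times M$ block is $c_{lk}R_{v,lk}^{(u)}$.
   Formalization: Both step-size convergence claims additionally assume that every R'_k is positive definite; with only R_{u,k} ≥ 0, R'_k may be singular, I−MR' then has eigenvalue 1, and I−B can be singular, leaving g undefined. *)

(* Defs.v *)
From HB Require Import structures.
From mathcomp Require Import all_boot all_order all_algebra finmap.
From mathcomp Require Import all_classical all_reals all_analysis.
From mathcomp Require Import complex mxtens.

Set Implicit Arguments.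
Unset Strict Implicit.
Unset Printing Implicit Defensive.

Import Order.TTheory GRing.Theory Num.Theory.
Import numFieldNormedType.Exports.

Local Open Scope classical_set_scope.
Local Open Scope ring_scope.
Local Open Scope complex_scope.
Local Open Scope sesquilinear_scope.

Section Matrices.
Variable R : realType.
Local Notation C := R[i].

(* [eigenvalue] is about row vectors (v *m A = a *: v), which gives the same
   spectrum as column vectors. The set is finite, so the sup is a max. *)
Definition spectral_radius n (A : 'M[C]_n) : R :=
  sup [set r : R | exists2 a : C, eigenvalue A a & r%:C = `|a|].

Definition stable n (A : 'M[C]_n) : Prop := spectral_radius A < 1.

(* Only meant for Hermitian A, whose eigenvalues are all real. *)
Definition lambda_max n (A : 'M[C]_n) : R :=
  sup [set x : R | eigenvalue A x%:C].

(* The order of R[i] makes z >= 0 and z > 0 entail that z is real. *)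
Definition psdmx n (A : 'M[C]_n) : Prop :=
  forall x : 'cV[C]_n, 0 <= (x^t* *m A *m x) 0 0.

Definition posdefmx n (A : 'M[C]_n) : Prop :=
  forall x : 'cV[C]_n, x != 0 -> 0 < (x^t* *m A *m x) 0 0.

(* Block matrices use the indexing of [tensmx]: coordinate r of 'I_(N * M) is
   coordinate (mxtens_unindex r).2 of block (mxtens_unindex r).1. *)
Definition blockmx N M (B : 'I_N -> 'I_N -> 'M[C]_M) : 'M[C]_(N * M) :=
  \matrix_(r, s) B (mxtens_unindex r).1 (mxtens_unindex s).1
                   (mxtens_unindex r).2 (mxtens_unindex s).2.

Definition blockdiag N M (D : 'I_N -> 'M[C]_M) : 'M[C]_(N * M) :=
  blockmx (fun k l => if k == l then D k else 0).

Definition blockcol N M (x : 'I_N -> 'cV[C]_M) : 'cV[C]_(N * M) :=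
  \col_r x (mxtens_unindex r).1 (mxtens_unindex r).2 0.

Definition complexmx m n (A : 'M[R]_(m, n)) : 'M[C]_(m, n) :=
  map_mx (real_complex R) A.

End Matrices.

Section RandomMatrices.
Context d (T : measurableType d) (R : realType) (P : probability T R).
Local Notation C := R[i].

(* Every entry has real and imaginary parts in L^p(P), measurability included. *)
Definition LpMx (p : \bar R) m n (X : T -> 'M[C]_(m, n)) : Prop :=
  forall i j, (fun t => complex.Re (X t i j)) \in Lfun P p /\
              (fun t => complex.Im (X t i j)) \in Lfun P p.

(* Meaningful only under [LpMx 1 X], since [fine] sends infinities to 0. *)
Definition expMx m n (X : T -> 'M[C]_(m, n)) : 'M[C]_(m, n) :=
  \matrix_(i, j) (fine ('E_P[fun t => complex.Re (X t i j)]) +i*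
                  fine ('E_P[fun t => complex.Im (X t i j)])).

Definition sigma_mx m n (X : T -> 'M[C]_(m, n)) : set (set T) :=
  <<s [set A | exists i j (B : set R), measurable B /\
         (A = (fun t => complex.Re (X t i j)) @^-1` B \/
          A = (fun t => complex.Im (X t i j)) @^-1` B)] >>.

Definition sigma_join (I : Type) (F : I -> set (set T)) : set (set T) :=
  <<s \bigcup_i F i >>.

Definition mutually_independent (I : choiceType) (F : I -> set (set T)) : Prop :=
  forall (J : {fset I}) (A : I -> set T), (forall j, j \in J -> F j (A j)) ->
    (P (\bigcap_(j in [set` J]) A j) = \prod_(j <- J) P (A j))%E.

End RandomMatrices.

(* Scalar signals are 1 x 1 matrices, so that every signal is matrix-valued.
   The estimates and the noises vw carry the time index -1, hence are stored
   with a shift: [vw l k i] is v^(w)_{lk,i-1}. All other signals are indexed by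
   their own time i >= 0. *)
Record diffusion (d : measure_display) (T : measurableType d) (R : realType)
    (N M : nat) := Diffusion {
  nbh   : 'I_N -> {set 'I_N};
  A1    : 'M[R]_N;
  A2    : 'M[R]_N;
  Cw    : 'M[R]_N;
  mu    : 'I_N -> R;
  wo    : 'cV[R[i]]_M;
  winit : 'I_N -> T -> 'cV[R[i]]_M;
  u     : 'I_N -> nat -> T -> 'rV[R[i]]_M;
  v     : 'I_N -> nat -> T -> 'M[R[i]]_1;
  vw    : 'I_N -> 'I_N -> nat -> T -> 'cV[R[i]]_M;
  vd    : 'I_N -> 'I_N -> nat -> T -> 'M[R[i]]_1;
  vu    : 'I_N -> 'I_N -> nat -> T -> 'rV[R[i]]_M;
  vpsi  : 'I_N -> 'I_N -> nat -> T -> 'cV[R[i]]_M;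
  Ru    : 'I_N -> 'M[R[i]]_M;
  sigma2_v : 'I_N -> R;
  Rvw   : 'I_N -> 'I_N -> 'M[R[i]]_M;
  sigma2_vd : 'I_N -> 'I_N -> R;
  Rvu   : 'I_N -> 'I_N -> 'M[R[i]]_M;
  Rvpsi : 'I_N -> 'I_N -> 'M[R[i]]_M }.

Section Strategy.
Context (d : measure_display) (T : measurableType d) (R : realType).
Context (N M : nat) (S : diffusion T R N M).
Local Notation C := R[i].

Definition d_node k i t : 'M[C]_1 := u S k i t *m wo S + v S k i t.

Definition d_link l k i t : 'M[C]_1 := d_node l i t + vd S l k i t.

Definition u_link l k i t : 'rV[C]_M := u S l i t + vu S l k i t.

(* phi_{k,i-1} and psi_{k,i} from the estimates w = w_{.,i-1}. *)
Definition phi_of (w : 'I_N -> T -> 'cV[C]_M) k i t : 'cV[C]_M :=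
  \sum_(l in nbh S k) (A1 S l k)%:C *: (w l t + vw S l k i t).

Definition psi_of (w : 'I_N -> T -> 'cV[C]_M) k i t : 'cV[C]_M :=
  phi_of w k i t + (mu S k)%:C *: \sum_(l in nbh S k) (Cw S l k)%:C *:
    ((u_link l k i t)^t* *m (d_link l k i t - u_link l k i t *m phi_of w k i t)).

(* [west n k] is w_{k,n-1}. *)
Fixpoint west (n : nat) : 'I_N -> T -> 'cV[C]_M :=
  if n is i.+1 then fun k t =>
    \sum_(l in nbh S k) (A2 S l k)%:C *: (psi_of (west i) l i t + vpsi S l k i t)
  else winit S.

(* [werr n] is the network error vector at time n - 1. *)
Definition werr n t : 'cV[C]_(N * M) := blockcol (fun k => wo S - west n k t).

Definition v_link l k i t : 'M[C]_1 :=
  if l == k then v S k i t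
  else v S l i t + vd S l k i t - vu S l k i t *m wo S.

Definition z_node k i t : 'cV[C]_M :=
  \sum_(l in nbh S k) (Cw S l k)%:C *: ((u_link l k i t)^t* *m v_link l k i t).

Definition znet i t : 'cV[C]_(N * M) := blockcol (fun k => z_node k i t).

Definition stepmx : 'M[C]_(N * M) := blockdiag (fun k => (mu S k)%:C%:M).

Definition A1net : 'M[C]_(N * M) := complexmx (A1 S) *t (1%:M : 'M[C]_M).
Definition A2net : 'M[C]_(N * M) := complexmx (A2 S) *t (1%:M : 'M[C]_M).

Definition Rprime_node k : 'M[C]_M :=
  \sum_(l in nbh S k) (Cw S l k)%:C *: (Ru S l + Rvu S l k).

Definition Rprime : 'M[C]_(N * M) := blockdiag Rprime_node.

Definition Rvc : 'M[C]_(N * M) :=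
  blockmx (fun k l => (Cw S l k)%:C *: Rvu S l k).

Definition zmean : 'cV[C]_(N * M) := - (Rvc *m ((const_mx 1 : 'cV_N) *t wo S)).

Definition Bmx : 'M[C]_(N * M) :=
  A2net^T *m (1%:M - stepmx *m Rprime) *m A1net^T.

Definition gss : 'cV[C]_(N * M) :=
  - (invmx (1%:M - Bmx) *m A2net^T *m stepmx *m zmean).

End Strategy.

Section Assumptions.
Context (d : measure_display) (T : measurableType d) (R : realType).
Context (P : probability T R) (N M : nat) (S : diffusion T R N M).

(* Connectedness ignores the direction of the links, so that it is the usual
   notion for symmetric neighborhoods without imposing symmetry. *)
Record network_ok : Prop := NetworkOk {
  nbh_refl : forall k, k \in nbh S k;
  nbh_connected : forall k l,
    connect (fun x y => (x \in nbh S y) || (y \in nbh S x)) k l;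
  A1_ge0 : forall l k, 0 <= A1 S l k;
  A2_ge0 : forall l k, 0 <= A2 S l k;
  Cw_ge0 : forall l k, 0 <= Cw S l k;
  A1_supp : forall l k, l \notin nbh S k -> A1 S l k = 0;
  A2_supp : forall l k, l \notin nbh S k -> A2 S l k = 0;
  Cw_supp : forall l k, l \notin nbh S k -> Cw S l k = 0;
  A1_sto : (A1 S)^T *m const_mx 1 = const_mx 1 :> 'cV_N;
  A2_sto : (A2 S)^T *m const_mx 1 = const_mx 1 :> 'cV_N;
  Cw_sto : Cw S *m const_mx 1 = const_mx 1 :> 'cV_N;
  mu_gt0 : forall k, 0 < mu S k }.

Definition sigma_u (x : 'I_N * nat) := sigma_mx (u S x.1 x.2).
Definition sigma_v (x : 'I_N * nat) := sigma_mx (v S x.1 x.2).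
Definition sigma_vw (x : 'I_N * 'I_N * nat) := sigma_mx (vw S x.1.1 x.1.2 x.2).
Definition sigma_vd (x : 'I_N * 'I_N * nat) := sigma_mx (vd S x.1.1 x.1.2 x.2).
Definition sigma_vu (x : 'I_N * 'I_N * nat) := sigma_mx (vu S x.1.1 x.1.2 x.2).
Definition sigma_vpsi (x : 'I_N * 'I_N * nat) :=
  sigma_mx (vpsi S x.1.1 x.1.2 x.2).

Definition sigma_families : 'I_6 -> set (set T) :=
  tnth [tuple sigma_join sigma_u; sigma_join sigma_v; sigma_join sigma_vw;
              sigma_join sigma_vd; sigma_join sigma_vu; sigma_join sigma_vpsi].

(* No independence is required between the initial estimates themselves. *)
Definition sigma_init : set (set T) := sigma_join (fun k => sigma_mx (winit S k)).

Record statistics_ok : Prop := StatisticsOk {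
  u_L2 : forall k i, LpMx P 2%:E (u S k i);
  u_mean : forall k i, expMx P (u S k i) = 0;
  u_cov : forall k i, expMx P (fun t => (u S k i t)^t* *m u S k i t) = Ru S k;
  Ru_psd : forall k, psdmx (Ru S k);
  u_white : mutually_independent P sigma_u;
  v_L2 : forall k i, LpMx P 2%:E (v S k i);
  v_mean : forall k i, expMx P (v S k i) = 0;
  v_cov : forall k i,
    expMx P (fun t => (v S k i t)^t* *m v S k i t) = (sigma2_v S k)%:C%:M;
  v_white : mutually_independent P sigma_v;
  vw_L2 : forall l k i, LpMx P 2%:E (vw S l k i);
  vw_mean : forall l k i, expMx P (vw S l k i) = 0;
  vw_cov : forall l k i,
    expMx P (fun t => vw S l k i t *m (vw S l k i t)^t*) = Rvw S l k;
  vw_white : mutually_independent P sigma_vw;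
  vd_L2 : forall l k i, LpMx P 2%:E (vd S l k i);
  vd_mean : forall l k i, expMx P (vd S l k i) = 0;
  vd_cov : forall l k i,
    expMx P (fun t => (vd S l k i t)^t* *m vd S l k i t) =
    (sigma2_vd S l k)%:C%:M;
  vd_white : mutually_independent P sigma_vd;
  vu_L2 : forall l k i, LpMx P 2%:E (vu S l k i);
  vu_mean : forall l k i, expMx P (vu S l k i) = 0;
  vu_cov : forall l k i,
    expMx P (fun t => (vu S l k i t)^t* *m vu S l k i t) = Rvu S l k;
  vu_white : mutually_independent P sigma_vu;
  vpsi_L2 : forall l k i, LpMx P 2%:E (vpsi S l k i);
  vpsi_mean : forall l k i, expMx P (vpsi S l k i) = 0;
  vpsi_cov : forall l k i,
    expMx P (fun t => vpsi S l k i t *m (vpsi S l k i t)^t*) = Rvpsi S l k;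
  vpsi_white : mutually_independent P sigma_vpsi;
  link_cov0 : forall l k, (l \notin nbh S k) || (l == k) ->
    [/\ Rvw S l k = 0, sigma2_vd S l k = 0, Rvu S l k = 0 & Rvpsi S l k = 0];
  families_indep : mutually_independent P sigma_families;
  winit_L1 : forall k, LpMx P 1 (winit S k);
  winit_indep : mutually_independent P
    (tnth [tuple sigma_init; sigma_join sigma_families]) }.

(* Invertibility of I - B is part of the claim, because g is defined by it. *)
Definition mean_converges : Prop :=
  (1%:M - Bmx S \in unitmx) /\
  (fun i => expMx P (werr S i) : 'cV[(R[i])^o]_(N * M)) @ \oo -->
    (gss S : 'cV[(R[i])^o]_(N * M)).

End Assumptions.

(* Main.v *)
(** Expanding psi_(k,i), the factor u_link^* u_link multiplying phi_(k,i-1) only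
    involves u and vu at time i, whereas phi_(k,i-1) is a function of the initial
    estimates, of u and vu at earlier times and of the other noises; these two
    sigma-algebras are independent, so expectations factor and the mean error
    obeys the stated affine recursion.  For stability, measure a network vector
    by the largest Euclidean norm of its blocks: by convexity of the squared
    norm, A1^T and A2^T do not increase it, since their rows are probability
    vectors, and the block-diagonal Hermitian matrix I - M R' contracts it by
    its spectral radius.  Hence every eigenvalue of B is bounded by
    rho(I - M R'), and the recursion is a contraction towards its fixed point. *)

Require Import Defs.
From HB Require Import structures.
From mathcomp Require Import all_boot all_order all_algebra finmap.
From mathcomp Require Import all_classical all_reals all_analysis.
From mathcomp Require Import complex mxtens.
From mathcomp Require Import measurable_realfun ring lra.

Set Implicit Arguments.
Unset Strict Implicit.
Unset Printing Implicit Defensive.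

Import Order.TTheory GRing.Theory Num.Theory.
Import numFieldNormedType.Exports.

Local Open Scope classical_set_scope.
Local Open Scope ring_scope.

(** * Hermitian matrices and the Euclidean norm *)

Section HermitianMatrices.
Variable R : realType.
Local Notation C := R[i].
Local Open Scope complex_scope.
Local Open Scope sesquilinear_scope.

(** The Euclidean operator norm of B cannot be used: A1 and A2 are stochastic in one direction only,
    so their transposes may expand it. This is why blocks are compared by a maximum. All estimates
    are kept in squared norms, with one constant c < 1 dominating the squared moduli of the
    eigenvalues of every diagonal block of I - M R'. That single contraction serves three times: at
    an eigenvector it bounds the spectrum of B, at the eigenvalue 1 it makes I - B invertible, and
    iterated on the mean error minus g it yields geometric convergence, without passing through
    powers of a matrix of spectral radius below 1. On the probabilistic side, the initial estimates
    are only integrable, so phi is only known to be in L^1, and no moment bound makes its product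
    with u_link^* u_link integrable. Independence must supply integrability along with the value of
    the mean; hence the product lemmas conclude both. *)

Definition normsq n (x : 'cV[C]_n) : R :=
  \sum_j ((complex.Re (x j 0)) ^+ 2 + (complex.Im (x j 0)) ^+ 2).

Lemma adjmxM m n p (A : 'M[C]_(m, n)) (B : 'M[C]_(n, p)) :
  (A *m B)^t* = B^t* *m A^t*.
Proof. by rewrite trmx_mul map_mxM. Qed.

Lemma normsqE n (x : 'cV[C]_n) : (x^t* *m x) 0 0 = (normsq x)%:C.
Proof.
rewrite mxE rmorph_sum; apply: eq_bigr => j _.
by rewrite !mxE -normCKC; apply/esym; exact: add_Re2_Im2.
Qed.

Lemma normsq_ge0 n (x : 'cV[C]_n) : 0 <= normsq x.
Proof. by apply: sumr_ge0 => j _; rewrite addr_ge0 ?sqr_ge0. Qed.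

Lemma normsq_entry n (x : 'cV[C]_n) j : `|x j 0| ^+ 2 <= (normsq x)%:C.
Proof.
rewrite -add_Re2_Im2 lecR /normsq (bigD1 j) //= lerDl.
by apply: sumr_ge0 => k _; rewrite addr_ge0 ?sqr_ge0.
Qed.

Lemma normsq_eq0 n (x : 'cV[C]_n) : normsq x = 0 -> x = 0.
Proof.
move=> x0; apply/colP => j; rewrite mxE; apply/eqP.
rewrite -normr_eq0 -sqrf_eq0 eq_le exprn_ge0 // andbT.
by rewrite (le_trans (normsq_entry x j)) // x0.
Qed.

Lemma normsqZ n a (x : 'cV[C]_n) : (normsq (a *: x))%:C = `|a| ^+ 2 * (normsq x)%:C.
Proof.
rewrite -!normsqE !mxE mulr_sumr; apply: eq_bigr => j _.
by rewrite !mxE rmorphM /= normCKC mulrACA.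
Qed.

Lemma normsq_unitary n (P : 'M[C]_n) x : P \is unitarymx ->
  normsq (P *m x) = normsq x.
Proof.
move=> Pu; apply: complexI; rewrite -!normsqE adjmxM mulmxA.
by rewrite -{2}[P]trmxCK mulmxtVK ?trmxC_unitary.
Qed.

Lemma normsq_diag n (c : R) (s : 'rV[C]_n) (y : 'cV[C]_n) :
  (forall i, `|s 0 i| ^+ 2 <= c%:C) -> normsq (diag_mx s *m y) <= c * normsq y.
Proof.
move=> sc; rewrite /normsq mulr_sumr; apply: ler_sum => j _.
by rewrite -lecR rmorphM /= !add_Re2_Im2 mul_diag_mx mxE normrM exprMn
  ler_wpM2r ?exprn_ge0.
Qed.

(** With A = P^-1 D P one has P A = D P, so the rows of P are left eigenvectors, which is exactly
    the row convention of [eigenvalue]. *)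
Lemma spectral_diag_eigenvalue n (A : 'M[C]_n) i : A \is normalmx ->
  eigenvalue A (spectral_diag A 0 i).
Proof.
move=> /orthomx_spectralP nA; set P := spectralmx A in nA.
have uP : P \in unitmx by exact: spectral_unit.
apply/eigenvalueP; exists (row i P).
  rewrite -row_mul {1}nA !mulmxA mulmxV // mul1mx.
  by apply/rowP => j; rewrite mul_diag_mx !mxE.
apply/eqP => P0.
have := congr1 (fun M => (M *m invmx P) 0 i) P0.
rewrite -row_mul mulmxV // mul0mx !mxE eqxx => /eqP.
by rewrite oner_eq0.
Qed.

Lemma herm_normalmx n (A : 'M[C]_n) : A^t* = A -> A \is normalmx.
Proof. by move=> hA; apply/normalmxP; rewrite hA. Qed.

(** After unitary diagonalisation the two unitary factors preserve the norm, and the diagonal one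
    scales each coordinate by an eigenvalue. *)
Lemma normal_normsq_le n (D : 'M[C]_n) (c : R) (x : 'cV[C]_n) :
  D \is normalmx -> (forall a, eigenvalue D a -> `|a| ^+ 2 <= c%:C) ->
  normsq (D *m x) <= c * normsq x.
Proof.
move=> nD hc; have uP := spectral_unitarymx D.
rewrite {1}(orthomx_spectralP nD) -!mulmxA invmx_unitary //.
rewrite normsq_unitary ?trmxC_unitary // -(normsq_unitary x uP).
by apply: normsq_diag => i; apply/hc/spectral_diag_eigenvalue.
Qed.

(** A [sup] is an upper bound only once its set is known to be bounded. The eigenvalues are the
    finitely many roots of the characteristic polynomial, and the sum of their moduli dominates each
    of them. *)
Lemma eigenvalue_bounded n (A : 'M[C]_n) :
  exists b : R, forall a, eigenvalue A a -> `|a| <= b%:C.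
Proof.
have [s sE] := closed_field_poly_normal (char_poly A).
exists (\sum_(a <- s) complex.Re `|a|) => a.
rewrite eigenvalue_root_char sE (monicP (char_poly_monic A)) scale1r.
rewrite root_prod_XsubC => /rot_to [i s' ss].
have -> : \sum_(a <- s) complex.Re `|a| = \sum_(a <- rot i s) complex.Re `|a|.
  by apply: perm_big; rewrite perm_sym perm_rot.
rewrite ss big_cons normc_def lecR lerDl.
by apply: sumr_ge0 => z _; rewrite normc_def /= sqrtr_ge0.
Qed.

Lemma eigenvalue_spectral_radius n (A : 'M[C]_n) a : eigenvalue A a ->
  `|a| <= (spectral_radius A)%:C.
Proof.
move=> ea; rewrite normc_def lecR.
have [b hb] := eigenvalue_bounded A.
apply: ub_le_sup; last by exists a; rewrite // normc_def.
by exists b => r [z ez rz]; rewrite -lecR rz hb.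
Qed.

Lemma eigenvalue_lambda_max n (A : 'M[C]_n) (x : R) : eigenvalue A x%:C ->
  x <= lambda_max A.
Proof.
move=> ex; have [b hb] := eigenvalue_bounded A.
apply: ub_le_sup => //; exists b => r /= /hb; rewrite normc_def lecR /=.
by rewrite expr0n /= addr0 sqrtr_sqr; exact/le_trans/ler_norm.
Qed.

Lemma herm_eigenvalue_real n (A : 'M[C]_n) (i : 'I_n) : A^t* = A ->
  exists r : R, spectral_diag A 0 i = r%:C.
Proof.
move=> hA; have /mxOverP/(_ 0 i) : spectral_diag A \is a realmx.
  by apply/hermitian_spectral_diag_real/is_hermitianmxP; rewrite expr0 scale1r hA.
case: (spectral_diag A 0 i) => a b /CrealP [/eqP].
by rewrite eqNr => /eqP ->; exists a.
Qed.

(** In an orthonormal eigenbasis the form is the sum of the real eigenvalues weighted by the squared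
    moduli of the coordinates. *)
Lemma rayleigh_le n (A : 'M[C]_n) (x : 'cV[C]_n) : A^t* = A ->
  (x^t* *m A *m x) 0 0 <= (lambda_max A * normsq x)%:C.
Proof.
move=> hA; have nA := herm_normalmx hA; have uP := spectral_unitarymx A.
have /orthomx_spectralP AE := nA.
set P := spectralmx A in AE uP; rewrite -(normsq_unitary x uP).
rewrite {1}AE invmx_unitary //.
have -> : x^t* *m (P^t* *m diag_mx (spectral_diag A) *m P) *m x =
   (P *m x)^t* *m (diag_mx (spectral_diag A) *m (P *m x)).
  by rewrite adjmxM !mulmxA.
move: (P *m x) => y; rewrite mxE rmorphM rmorph_sum mulr_sumr.
apply: ler_sum => i _; rewrite mul_diag_mx !mxE mulrCA -normCKC.
rewrite -[X in _ <= _ * X]/(((complex.Re (y i 0)) ^+ 2 + (complex.Im (y i 0)) ^+ 2)%:C).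
rewrite add_Re2_Im2 ler_wpM2r ?exprn_ge0 //.
have [r ri] := herm_eigenvalue_real i hA; rewrite ri lecR.
by apply: eigenvalue_lambda_max; rewrite -ri spectral_diag_eigenvalue.
Qed.

(** Bridges the row convention of [eigenvalue] and the column vectors of the network: a matrix and
    its transpose have the same characteristic polynomial. *)
Lemma eigenvalue_trmx n (A : 'M[C]_n) a : eigenvalue A^T a = eigenvalue A a.
Proof.
rewrite !eigenvalue_root_char /char_poly -[in RHS]det_tr; congr (root (\det _) _).
by apply/matrixP => i j; rewrite !mxE eq_sym.
Qed.

Lemma eigenvalue_col n (A : 'M[C]_n) a : eigenvalue A a ->
  exists2 x : 'cV[C]_n, x != 0 & A *m x = a *: x.
Proof.
move=> ea; have /eigenvalueP[v vA v0] : eigenvalue A^T a.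
  by rewrite eigenvalue_trmx.
exists v^T; first by rewrite trmx_eq0.
by apply: trmx_inj; rewrite trmx_mul trmxK vA linearZ /= trmxK.
Qed.

Lemma col_eigenvalue n (A : 'M[C]_n) a (x : 'cV[C]_n) : x != 0 ->
  A *m x = a *: x -> eigenvalue A a.
Proof.
move=> x0 Ax; rewrite -eigenvalue_trmx.
apply/eigenvalueP; exists x^T; last by rewrite trmx_eq0.
by rewrite -trmx_mul Ax linearZ.
Qed.

(** A strict bound on finitely many moduli leaves a uniform gap. Starting the maximum at 0 makes c
    nonnegative and covers an empty spectrum. *)
Lemma eigenvalue_lt1_uniform n (A : 'M[C]_n) :
  (forall a, eigenvalue A a -> `|a| < 1) ->
  exists c : R, 0 <= c < 1 /\ forall a, eigenvalue A a -> `|a| ^+ 2 <= c%:C.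
Proof.
move=> A1; have [s sE] := closed_field_poly_normal (char_poly A).
have es a : eigenvalue A a = (a \in s).
  rewrite eigenvalue_root_char sE (monicP (char_poly_monic A)) scale1r.
  by rewrite root_prod_XsubC.
pose f (a : C) := complex.Re a ^+ 2 + complex.Im a ^+ 2.
exists (\big[Num.max/0]_(a <- s) f a); split; last first.
  move=> a; rewrite es => sa; rewrite -add_Re2_Im2 lecR.
  exact: (le_bigmax_seq _ a xpredT f sa).
apply/andP; split; first exact: bigmax_ge_id.
rewrite big_seq; apply: bigmax_lt => // a; rewrite -es => /A1 a1.
by rewrite -ltcR /f add_Re2_Im2 rmorph1 expr_lt1.
Qed.

Lemma posdefmx_eigenvalue n (A : 'M[C]_n) (l : C) : posdefmx A ->
  eigenvalue A l -> 0 < l.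
Proof.
move=> pA /eigenvalue_col[x x0 Ax]; have := pA x x0.
rewrite -mulmxA Ax -scalemxAr mxE normsqE pmulr_lgt0 // ltcR.
rewrite lt_neqAle normsq_ge0 andbT eq_sym.
by apply: contraNneq x0 => /normsq_eq0 ->.
Qed.

(** The form at an eigenvector is the eigenvalue times the squared norm; being positive in the order
    of [R[i]], the eigenvalue is real. *)
Lemma posdefmx_eigenvalueR n (A : 'M[C]_n) (l : C) : posdefmx A ->
  eigenvalue A l -> exists2 r : R, l = r%:C & 0 < r <= lambda_max A.
Proof.
move=> pA el; have := posdefmx_eigenvalue pA el; case: l el => r q el.
rewrite ltcE /= => /andP[/eqP q0 r0]; rewrite q0 in el *.
by exists r => //; rewrite r0 eigenvalue_lambda_max.
Qed.

End HermitianMatrices.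

(** * The block maximum norm *)

Section BlockVectors.
Variables (R : realType) (N M : nat).
Local Notation C := R[i].
Local Open Scope complex_scope.
Local Open Scope sesquilinear_scope.
Implicit Types x y : 'cV[C]_(N * M).

Definition blk x k : 'cV[C]_M := \col_j x (mxtens_index (k, j)) 0.

Lemma blkP x y : (forall k, blk x k = blk y k) -> x = y.
Proof.
move=> xy; apply/colP => r; case: (mxtens_indexP r) => k j.
by have /colP/(_ j) := xy k; rewrite !mxE.
Qed.

Lemma blk_blockcol f k : blk (blockcol f) k = f k.
Proof. by apply/colP => j; rewrite !mxE mxtens_indexK. Qed.

Lemma blkD x y k : blk (x + y) k = blk x k + blk y k.
Proof. by apply/colP => j; rewrite !mxE. Qed.

Lemma blkN x k : blk (- x) k = - blk x k.
Proof. by apply/colP => j; rewrite !mxE. Qed.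

Lemma blkZ a x k : blk (a *: x) k = a *: blk x k.
Proof. by apply/colP => j; rewrite !mxE. Qed.

Lemma blk_const_tens (w : 'cV[C]_M) k :
  blk ((const_mx 1 : 'cV_N) *t w : 'cV_(N * M)) k = w.
Proof.
apply/colP => j; rewrite !mxE mxtens_indexK mul1r.
by congr (w _ _); apply/val_inj; rewrite /= mod0n.
Qed.

Lemma sum_mxtens_index (V : nmodType) (F : 'I_(N * M) -> V) :
  \sum_r F r = \sum_k \sum_j F (mxtens_index (k, j)).
Proof.
rewrite pair_big /= (reindex (@mxtens_index N M)) /=.
  by apply: eq_bigr => -[].
exists (@mxtens_unindex N M) => r _; [exact: mxtens_indexK|exact: mxtens_unindexK].
Qed.

Lemma blk_blockmx (B : 'I_N -> 'I_N -> 'M[C]_M) x k :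
  blk (blockmx B *m x) k = \sum_l B k l *m blk x l.
Proof.
apply/colP => j; rewrite !mxE sum_mxtens_index summxE; apply: eq_bigr => l _.
by rewrite mxE; apply: eq_bigr => i _; rewrite !mxE !mxtens_indexK.
Qed.

Lemma blk_blockdiag (D : 'I_N -> 'M[C]_M) x k :
  blk (blockdiag D *m x) k = D k *m blk x k.
Proof.
rewrite blk_blockmx (bigD1 k) //= eqxx big1 ?addr0 // => l lk.
by rewrite eq_sym (negPf lk) mul0mx.
Qed.

Lemma blk_tens (A : 'M[R]_N) x k :
  blk ((complexmx A *t (1%:M : 'M[C]_M))^T *m x) k =
  \sum_l (A l k)%:C *: blk x l.
Proof.
have -> : (complexmx A *t (1%:M : 'M[C]_M))^T =
    blockmx (fun k l => (A l k)%:C%:M).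
  apply/matrixP => r s; rewrite !mxE.
  by rewrite mulr_natr [in LHS]eq_sym.
by rewrite blk_blockmx; apply: eq_bigr => l _; rewrite mul_scalar_mx.
Qed.

Lemma blockdiag_subM (D E : 'I_N -> 'M[C]_M) :
  1%:M - blockdiag D *m blockdiag E = blockdiag (fun k => 1%:M - D k *m E k).
Proof.
apply/matrixP => r s.
(* It is enough to compare the actions on columns, taken here as the standard basis vectors; the
   action can then be computed block by block. *)
suff H x : (1%:M - blockdiag D *m blockdiag E) *m x =
    blockdiag (fun k => 1%:M - D k *m E k) *m x.
  have := congr1 (fun y : 'cV[C]_(N * M) => y r 0) (H (col s 1%:M)).
  by rewrite !colE !mul1mx -!colE !mxE.
apply: blkP => k; rewrite blk_blockdiag !mulmxBl blkD blkN !mul1mx.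
by rewrite -!mulmxA !blk_blockdiag.
Qed.

(** An eigenvector of one block, extended by zero to the other blocks, is an eigenvector of the
    whole matrix. *)
Lemma eigenvalue_blockdiag (D : 'I_N -> 'M[C]_M) k a :
  eigenvalue (D k) a -> eigenvalue (blockdiag D) a.
Proof.
move=> /eigenvalue_col [y y0 Dy].
pose x := blockcol (fun l => if l == k then y else 0).
have xk : blk x k = y by rewrite blk_blockcol eqxx.
apply: (@col_eigenvalue _ _ _ _ x).
  by apply: contraNneq y0 => x0; rewrite -xk x0; apply/eqP/colP => j; rewrite !mxE.
apply: blkP => l; rewrite blk_blockdiag blkZ blk_blockcol.
by case: eqP => [->|_]; rewrite ?mulmx0 ?scaler0.
Qed.

(** The difference of the two sides is the variance of z under the weights a. *)
Lemma convex_sqr (a z : 'I_N -> R) : (forall l, 0 <= a l) -> \sum_l a l = 1 ->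
  (\sum_l a l * z l) ^+ 2 <= \sum_l a l * z l ^+ 2.
Proof.
move=> a0 a1; set m := \sum_l _.
rewrite -subr_ge0; have <- : \sum_l a l * (z l - m) ^+ 2 =
    \sum_l a l * z l ^+ 2 - m ^+ 2.
  rewrite (eq_bigr (fun l => a l * z l ^+ 2 + - (2 * m) * (a l * z l) +
    m ^+ 2 * a l)); last by move=> l _; ring.
  by rewrite !big_split /= -!mulr_sumr a1 -/m; ring.
by apply: sumr_ge0 => l _; rewrite mulr_ge0 ?sqr_ge0.
Qed.

(** The weights are real, so the scalar inequality applies separately to the real and imaginary
    parts of each coordinate. *)
Lemma normsq_convex (a : 'I_N -> R) (x : 'I_N -> 'cV[C]_M) :
  (forall l, 0 <= a l) -> \sum_l a l = 1 ->
  normsq (\sum_l (a l)%:C *: x l) <= \sum_l a l * normsq (x l).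
Proof.
move=> a0 a1; rewrite /normsq.
under [leRHS]eq_bigr => l _ do rewrite mulr_sumr.
rewrite exchange_big /=; apply: ler_sum => j _.
have -> : (\sum_l (a l)%:C *: x l) j 0 =
    (\sum_l a l * complex.Re (x l j 0)) +i* (\sum_l a l * complex.Im (x l j 0)).
  rewrite summxE; elim/big_ind3 : _ => // [_ b c _ b' c' -> ->//|l _].
  by rewrite !mxE; case: (x l j 0) => p q; simpc.
rewrite /=; under [leRHS]eq_bigr => l _ do rewrite mulrDr.
by rewrite big_split /=; apply: lerD; apply: convex_sqr.
Qed.

(** States that the squared block maximum norm is at most b. As a predicate it avoids both a square
    root and a maximum over the nodes. *)
Definition blkbound x (b : R) := forall k, normsq (blk x k) <= b.

Lemma blkbound_tens (A : 'M[R]_N) x b : (forall l k, 0 <= A l k) ->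
  A^T *m const_mx 1 = const_mx 1 :> 'cV_N -> blkbound x b ->
  blkbound ((complexmx A *t (1%:M : 'M[C]_M))^T *m x) b.
Proof.
move=> A0 A1 xb k; rewrite blk_tens.
have Ak : \sum_l A l k = 1.
  have /colP/(_ k) := A1; rewrite !mxE => <-.
  by apply: eq_bigr => l _; rewrite !mxE mulr1.
apply: le_trans (normsq_convex _ _ _) _ => //.
rewrite -[leRHS]mul1r -Ak mulr_suml; apply: ler_sum => l _.
by rewrite ler_wpM2l.
Qed.

Lemma blkbound_diffusion (A B : 'M[R]_N) (D : 'I_N -> 'M[C]_M) (c : R) x b :
  (forall l k, 0 <= A l k) -> A^T *m const_mx 1 = const_mx 1 :> 'cV_N ->
  (forall l k, 0 <= B l k) -> B^T *m const_mx 1 = const_mx 1 :> 'cV_N ->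
  0 <= c -> (forall k (y : 'cV_M), normsq (D k *m y) <= c * normsq y) -> blkbound x b ->
  blkbound ((complexmx B *t (1%:M : 'M[C]_M))^T *m blockdiag D *m
            (complexmx A *t (1%:M : 'M[C]_M))^T *m x) (c * b).
Proof.
move=> A0 A1 B0 B1 c0 Dc xb; rewrite -!mulmxA; apply: blkbound_tens => // k.
rewrite blk_blockdiag (le_trans (Dc _ _)) // ler_wpM2l //.
exact: blkbound_tens.
Qed.

(* At an eigenvector, apply the bound to the block of largest norm. *)
Lemma blkbound_eigenvalue (B : 'M[C]_(N * M)) (c : R) a :
  (forall x b, blkbound x b -> blkbound (B *m x) (c * b)) ->
  eigenvalue B a -> `|a| ^+ 2 <= c%:C.
Proof.
move=> Bc /eigenvalue_col [x x0 Bx].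
have [l0 xl0] : exists l, normsq (blk x l) != 0.
  apply/existsP; apply: contraNT x0; rewrite negb_exists => /forallP x0.
  apply/eqP/blkP => k; rewrite (normsq_eq0 (eqP (negPn (x0 k)))).
  by apply/colP => j; rewrite !mxE.
pose k := [arg max_(k > l0) normsq (blk x k)]%O.
have kmax l : normsq (blk x l) <= normsq (blk x k).
  by rewrite /k; case: arg_maxP => // i _; apply.
have := Bc x _ kmax k; rewrite Bx blkZ -lecR normsqZ rmorphM /= => H.
rewrite -(ler_pM2r (x := (normsq (blk x k))%:C)) // ltcR.
by rewrite (lt_le_trans _ (kmax l0)) // lt_neqAle eq_sym xl0 normsq_ge0.
Qed.

(** The squared block norms of e n - g are at most c^n times their initial bound, and each entry is
    dominated by the norm of its block. *)
Lemma blkbound_cvg (e : nat -> 'cV[C]_(N * M)) (g : 'cV[C]_(N * M))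
    (B : 'M[C]_(N * M)) (c : R) : 0 <= c < 1 ->
  (forall x b, blkbound x b -> blkbound (B *m x) (c * b)) ->
  (forall n, e n.+1 - g = B *m (e n - g)) ->
  (e : nat -> 'cV[C^o]_(N * M)) @ \oo --> (g : 'cV[C^o]_(N * M)).
Proof.
move=> /andP[c0 c1] Bc eS.
pose b := \sum_k normsq (blk (e 0%N - g) k).
have b0 : 0 <= b by apply: sumr_ge0 => k _; exact: normsq_ge0.
have eb n : blkbound (e n - g) (c ^+ n * b).
  elim: n => [|n IH]; last by rewrite eS exprS -mulrA; exact: Bc.
  move=> k; rewrite expr0 mul1r /b (bigD1 k) //= lerDl.
  by apply: sumr_ge0 => l _; exact: normsq_ge0.
have cb0 : (fun n => c ^+ n * b) @ \oo --> (0 : R).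
  rewrite -[X in _ --> X](mul0r b); apply: cvgMl.
  by apply: cvg_expr; rewrite ger0_norm.
apply/cvg_ballP => eps eps0.
(* Radii of balls lie in [R[i]], where being positive forces them to be real. *)
have [r epsE] : exists r : R, eps = r%:C.
  by case: eps eps0 => p q; rewrite ltcE /= => /andP[/eqP -> _]; exists p.
rewrite epsE ltcR in eps0.
(* The decay is known for squared norms, so the threshold is r^2. *)
have r2 : 0 < r ^+ 2 by rewrite exprn_gt0.
near=> n; have cn : c ^+ n * b < r ^+ 2 by near: n; exact: (cvgr_lt _ cb0 _ r2).
split=> [|i j]; first by rewrite epsE ltcR.
case: (mxtens_indexP i) => k {}i; rewrite (ord1 j) /ball /= epsE.
have : `|blk (e n - g) k i 0| < r%:C.
  rewrite -ltr_sqr ?nnegrE ?normr_ge0 ?ler0c ?(ltW eps0) //.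
  rewrite (le_lt_trans (normsq_entry _ _)) // -(rmorphXn (real_complex R)) ltcR.
  by rewrite (le_lt_trans (eb n k)).
by rewrite !mxE -normrN opprB.
Unshelve. all: by end_near. Qed.

End BlockVectors.

(** * Stability of the mean recursion *)

Section NetworkStability.
Context (d : measure_display) (T : measurableType d) (R : realType).
Context (N M : nat) (S : diffusion T R N M).
Local Notation C := R[i].
Local Open Scope complex_scope.
Local Open Scope sesquilinear_scope.

Definition stepblk k : 'M[C]_M := 1%:M - (mu S k)%:C%:M *m Rprime_node S k.

Lemma step_blockdiag : 1%:M - stepmx S *m Rprime S = blockdiag stepblk.
Proof. exact: blockdiag_subM. Qed.

(** One contraction factor for the squared norms, common to all nodes; c plays the role of the
    square of the spectral radius of I - M R'. *)
Definition stepbound (c : R) :=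
  0 <= c < 1 /\ forall k a, eigenvalue (stepblk k) a -> `|a| ^+ 2 <= c%:C.

Lemma stepbound_ex : (forall k a, eigenvalue (stepblk k) a -> `|a| < 1) ->
  exists c, stepbound c.
Proof.
move=> H; have /choice[c cP] k := eigenvalue_lt1_uniform (H k).
exists (\big[Num.max/0]_k c k); split.
  rewrite bigmax_ge_id bigmax_lt // => k _.
  by have [/andP[]] := cP k.
move=> k a /(proj2 (cP k)) /le_trans; apply.
by rewrite lecR; exact: le_bigmax.
Qed.

Hypothesis hM : (0 < M)%N.
Hypothesis hnet : network_ok S.
Hypothesis hR : forall k, (Rprime_node S k)^t* = Rprime_node S k.

Lemma stepblk_herm k : (stepblk k)^t* = stepblk k.
Proof.
rewrite /stepblk raddfB /= map_mxB trmx1 map_mx1 adjmxM hR.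
rewrite tr_scalar_mx map_scalar_mx /= mul_scalar_mx mul_mx_scalar.
by congr (_ - _ *: _); apply: conjc_real.
Qed.

Lemma Bmx_blkbound c (x : 'cV[C]_(N * M)) b : stepbound c ->
  blkbound x b -> blkbound (Bmx S *m x) (c * b).
Proof.
move=> [/andP[c0 _] cP]; rewrite /Bmx step_blockdiag.
apply: blkbound_diffusion => //; try by case: hnet.
move=> k y; apply: normal_normsq_le; first exact/herm_normalmx/stepblk_herm.
exact: cP.
Qed.

Lemma Bmx_eigenvalue c a : stepbound c -> eigenvalue (Bmx S) a ->
  `|a| ^+ 2 <= c%:C.
Proof.
by move=> hc; apply: blkbound_eigenvalue => x b; exact: Bmx_blkbound.
Qed.

(** Passing to a supremum could lose strictness; here all the moduli stay below sqrt c, which is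
    itself less than 1. *)
Lemma stable_Bmx : (0 < N)%N -> stable (1%:M - stepmx S *m Rprime S) ->
  stable (Bmx S).
Proof.
move=> hN; rewrite /stable step_blockdiag => st.
have [c hc] : exists c, stepbound c.
  apply: stepbound_ex => k a /eigenvalue_blockdiag/eigenvalue_spectral_radius.
  by move=> /le_lt_trans; apply; rewrite -(rmorph1 (real_complex R)) ltcR.
have /andP[c0 c1] := hc.1.
apply: (@le_lt_trans _ _ (Num.sqrt c)); last first.
  by rewrite -(@sqrtr1 R) ltr_sqrt.
apply: ge_sup.
  (* An upper bound of a set dominates its [sup] when the set is nonempty: over an algebraically
     closed field a matrix of positive size has an eigenvalue. *)
  have [a ea] := eigenvalue_closed (Bmx S) (n := N * M) ltac:(by rewrite muln_gt0 hN).
  by eexists; exists a; [exact: ea|rewrite normc_def].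
move=> r [a ea ra]; have := Bmx_eigenvalue hc ea.
rewrite -ra -(rmorphXn (real_complex R)) lecR => /ler_wsqrtr.
by rewrite sqrtr_sqr; apply: le_trans; exact: ler_norm.
Qed.

(** The squared modulus of 1 exceeds c, so 1 is not an eigenvalue of B. Then I - B is invertible, g
    is the fixed point of the recursion, and e n - g is simply multiplied by B at each step. *)
Lemma mean_error_cvg c (e : nat -> 'cV[C]_(N * M)) : stepbound c ->
  (forall n, e n.+1 = Bmx S *m e n - (A2net S)^T *m stepmx S *m zmean S) ->
  (1%:M - Bmx S \in unitmx) /\
  (e : nat -> 'cV[C^o]_(N * M)) @ \oo --> (gss S : 'cV[C^o]_(N * M)).
Proof.
move=> hc eS.
have uB : 1%:M - Bmx S \in unitmx.
  have -> : 1%:M - Bmx S = (-1) *: (Bmx S - 1%:M) by rewrite scaleN1r opprB.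
  rewrite unitmxZ ?unitrN1 // -row_free_unit -kermx_eq0; apply: contraT => B1.
  (* The nonzero kernel of B - I is by definition the eigenspace of B for 1. *)
  have /(Bmx_eigenvalue hc) : eigenvalue (Bmx S) 1 by [].
  rewrite normr1 expr1n -(rmorph1 (real_complex R)) lecR.
  by case/andP: hc.1 => _ c1 /(lt_le_trans c1); rewrite ltxx.
split=> //; apply: (@blkbound_cvg _ _ _ _ _ (Bmx S) c hc.1).
  by move=> x b; exact: Bmx_blkbound.
move=> n; rewrite eS mulmxBr.
have gE : (1%:M - Bmx S) *m gss S = - ((A2net S)^T *m stepmx S *m zmean S).
  by rewrite /gss mulmxN -!mulmxA mulKVmx.
rewrite -gE mulmxBl mul1mx; move: (Bmx S *m e n) (Bmx S *m gss S) => p q.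
by rewrite addrA addrAC addrK.
Qed.

Hypothesis pdR : forall k, posdefmx (Rprime_node S k).

Lemma lambda_max_gt0 k : 0 < lambda_max (Rprime_node S k).
Proof.
have [l el] := eigenvalue_closed (Rprime_node S k) hM.
by have [r _ /andP[]] := posdefmx_eigenvalueR (@pdR k) el; apply: lt_le_trans.
Qed.

(** An eigenvalue of I - mu R' has the form 1 - mu r with r an eigenvalue of R'. Positive
    definiteness gives r > 0, which keeps it below 1; r <= lambda_max and the step-size bound keep
    it above -1. *)
Lemma stepbound_lambda_max :
  (forall k, mu S k < 2 / lambda_max (Rprime_node S k)) ->
  exists c, stepbound c.
Proof.
move=> hmu; apply: stepbound_ex => k a /eigenvalue_col[x x0].
rewrite /stepblk mulmxBl mul1mx mul_scalar_mx -scalemxAl => xE.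
have m0 : 0 < mu S k by case: hnet.
have mC0 : (mu S k)%:C != 0 by rewrite (fmorph_eq0 (real_complex R)) gt_eqF.
have Rx : Rprime_node S k *m x = ((1 - a) / (mu S k)%:C) *: x.
  rewrite mulrC -scalerA scalerBl scale1r -xE opprB addrC subrK.
  by rewrite scalerA mulVf // scale1r.
have [r rE /andP[r0 rl]] := posdefmx_eigenvalueR (@pdR k) (col_eigenvalue x0 Rx).
have -> : a = (1 - mu S k * r)%:C.
  by rewrite rmorphB rmorph1 rmorphM /= -rE mulrC divfK // opprB addrC subrK.
have lm0 := lambda_max_gt0 k.
have := hmu k; rewrite ltr_pdivlMr // => ml.
have mr : mu S k * r <= mu S k * lambda_max (Rprime_node S k).
  by rewrite ler_wpM2l // ltW.
have mr0 : 0 < mu S k * r by rewrite mulr_gt0.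
rewrite normc_def /= expr0n /= addr0 sqrtr_sqr -(rmorph1 (real_complex R)) ltcR.
by rewrite ltr_norml; apply/andP; split; lra.
Qed.

(** When the columns of C sum to 1, R'_k is a convex combination of the matrices Ru_l + Rvu_lk, so
    its quadratic form at an eigenvector is at most the same combination of their Rayleigh
    bounds. *)
Lemma lambda_max_doubly_stochastic k :
  (Cw S)^T *m const_mx 1 = const_mx 1 :> 'cV_N ->
  (forall l, (Ru S l + Rvu S l k)^t* = Ru S l + Rvu S l k) ->
  lambda_max (Rprime_node S k) <=
  \big[Num.max/0]_(l in nbh S k) lambda_max (Ru S l + Rvu S l k).
Proof.
move=> C1 hl; set m := \big[_/_]_(_ in _) _.
have [l0 el0] := eigenvalue_closed (Rprime_node S k) hM.
have [r0 r0E _] := posdefmx_eigenvalueR (@pdR k) el0.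
apply: ge_sup; first by exists r0; rewrite /= -r0E.
move=> r /= /eigenvalue_col[x x0 xE].
have nx : 0 < normsq x.
  rewrite lt_neqAle normsq_ge0 andbT eq_sym.
  by apply: contraNneq x0 => /normsq_eq0 ->.
rewrite -(ler_pM2r nx) -lecR.
have <- : (x^t* *m Rprime_node S k *m x) 0 0 = (r * normsq x)%:C.
  by rewrite -mulmxA xE -scalemxAr mxE normsqE rmorphM.
have Ck : \sum_(l in nbh S k) Cw S l k = 1.
  have /colP/(_ k) := C1; rewrite !mxE => <-.
  rewrite big_mkcond; apply: eq_bigr => l _; rewrite !mxE mulr1.
  by case: ifPn => // /(Cw_supp hnet).
rewrite /Rprime_node mulmx_sumr mulmx_suml summxE.
rewrite -[m]mul1r -Ck mulr_suml mulr_suml rmorph_sum; apply: ler_sum => l lk.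
rewrite -scalemxAr -scalemxAl mxE -mulrA rmorphM /=.
apply: ler_wpM2l; first by rewrite ler0c (Cw_ge0 hnet).
apply: le_trans (rayleigh_le _ (hl l)) _.
by rewrite lecR ler_pM2r // le_bigmax_cond.
Qed.

Lemma stepbound_doubly_stochastic :
  (Cw S)^T *m const_mx 1 = const_mx 1 :> 'cV_N ->
  (forall k l, (Ru S l + Rvu S l k)^t* = Ru S l + Rvu S l k) ->
  (forall k, mu S k <
     2 / \big[Num.max/0]_(l in nbh S k) lambda_max (Ru S l + Rvu S l k)) ->
  exists c, stepbound c.
Proof.
move=> C1 hl hmu; apply: stepbound_lambda_max => k.
apply: lt_le_trans (hmu k) _.
have := lambda_max_doubly_stochastic C1 (hl k); have := lambda_max_gt0 k.
(* The maximum is positive because it dominates lambda_max of R'_k; this permits comparing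
   inverses. *)
move=> l0 ll; rewrite ler_pM2l // lef_pV2 // posrE //.
exact: lt_le_trans ll.
Qed.

End NetworkStability.

(** * Independent sigma-algebras *)

Section Independence.
Context (d : measure_display) (T : measurableType d) (R : realType).
Context (P : probability T R).
Local Open Scope ereal_scope.
Implicit Types F G : set (set T).

Definition indep F G :=
  forall A B, F A -> G B -> P (A `&` B) = P A * P B.

Lemma indepC F G : indep F G -> indep G F.
Proof. by move=> FG A B GA FB; rewrite setIC FG // muleC. Qed.

Lemma sub_indep F F' G G' : F' `<=` F -> G' `<=` G -> indep F G -> indep F' G'.
Proof. by move=> sF sG FG A B /sF FA /sG GB; exact: FG. Qed.

Lemma sub_smallest_measurable F : F `<=` measurable -> <<s F >> `<=` measurable.
Proof. by move=> mF; apply: smallest_sub => //; exact: sigma_algebra_measurable. Qed.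

(** Dynkin's argument: for fixed B, the sets A obeying the product rule form a Dynkin system, and it
    contains the pi-system F. *)
Lemma indep_sigma F G : F `<=` measurable -> G `<=` measurable ->
  setI_closed F -> indep F G -> indep <<s F >> G.
Proof.
move=> mF mG IF FG A B FA GB; move: A FA.
have mB := mG _ GB.
pose L := [set A | measurable A /\ P (A `&` B) = P A * P B].
suff : <<s F >> `<=` L by move=> FL A /FL[].
rewrite -setI_closed_g_dynkin_g_sigma_algebra //; apply: smallest_sub.
  split=> [|A [mA PA]|A tA AL].
  - by split=> //; rewrite setTI probability_setT mul1e.
  - split; first exact: measurableC.
    rewrite probability_setC // muleBl ?fin_num_measure // mul1e -PA.
    rewrite setIC -setDE setIC measureD //.
    by rewrite -ge0_fin_numE ?fin_num_measure.
  - have mA n : measurable (A n) by case: (AL n).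
    split; first exact: bigcup_measurable.
    have mAB n : measurable (A n `&` B) by exact: measurableI.
    have tAB : trivIset setT (fun n => A n `&` B) by exact: trivIset_setIr.
    have mUA : measurable (\bigcup_n A n) by exact: bigcup_measurable.
    have mUAB : measurable (\bigcup_n (A n `&` B)) by exact: bigcup_measurable.
    rewrite setI_bigcupl (measure_semi_bigcup P mAB) //.
    rewrite (measure_semi_bigcup P mA) //.
    rewrite muleC -(fineK (fin_num_measure P _ mB)) -nneseriesZl //.
    apply: eq_eseriesr => n _; rewrite fineK ?fin_num_measure //.
    by rewrite muleC; case: (AL n).
by move=> A FA; split; [exact: mF|exact: FG].
Qed.

Lemma indep_sigma2 F G : F `<=` measurable -> G `<=` measurable ->
  setI_closed F -> setI_closed G -> indep F G -> indep <<s F >> <<s G >>.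
Proof.
move=> mF mG IF IG FG; apply: indep_sigma => //; first exact: sub_smallest_measurable.
by apply/indepC/indep_sigma => //; exact/indepC.
Qed.

Definition sub_sigma F := sigma_algebra setT F /\ F `<=` measurable.

Lemma sub_sigmaT F : sub_sigma F -> F setT.
Proof. by case=> -[F0 FC _] _; rewrite -(setD0 setT); exact: FC. Qed.

Lemma sub_sigmaI F : sub_sigma F -> setI_closed F.
Proof. by case=> /sigma_algebraP []. Qed.

Lemma sub_sigma_gen F : F `<=` measurable -> sub_sigma <<s F >>.
Proof.
by move=> mF; split; [exact: smallest_sigma_algebra|exact: sub_smallest_measurable].
Qed.

(* The intersections of an element of G1 and one of G2 form a pi-system. *)
Lemma indep_joinr F G1 G2 : sub_sigma F -> sub_sigma G1 -> sub_sigma G2 ->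
  indep F G1 -> indep <<s F `|` G1 >> G2 -> indep F <<s G1 `|` G2 >>.
Proof.
move=> sF s1 s2 i1 i2.
pose Pi := [set A | exists B1 B2, [/\ G1 B1, G2 B2 & A = B1 `&` B2]].
have sub : <<s G1 `|` G2 >> `<=` <<s Pi >>.
  apply: sub_smallest2r; first exact: smallest_sigma_algebra.
  move=> A [GA|GA].
    by exists A, setT; split=> //; [exact: sub_sigmaT|rewrite setIT].
  by exists setT, A; split=> //; [exact: sub_sigmaT|rewrite setTI].
apply: (sub_indep (F := F) (G := <<s Pi >>)) => //; apply/indepC/indep_sigma.
- by move=> _ [B1 [B2 [GB1 GB2 ->]]]; apply: measurableI; [apply: s1.2|apply: s2.2].
- exact: sF.2.
- move=> _ _ [A1 [A2 [GA1 GA2 ->]]] [B1 [B2 [GB1 GB2 ->]]].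
  exists (A1 `&` B1), (A2 `&` B2); split; last by rewrite setIACA.
    exact: sub_sigmaI.
  exact: sub_sigmaI.
apply/indepC => A _ FA [B1 [B2 [GB1 GB2 ->]]].
rewrite setIA i2 //; last first.
  apply: (sub_sigmaI (sub_sigma_gen _)).
  - by move=> B [/sF.2|/s1.2].
  - by apply: sub_gen_smallest; left.
  - by apply: sub_gen_smallest; right.
(* What remains is P B1 * P B2 = P (B1 [&] B2), which is again [i2], since B1 also belongs to the
   join of F and G1. *)
rewrite i1 // -muleA; congr (_ * _); apply/esym.
rewrite i2 //; apply: sub_gen_smallest; right; exact: GB1.
Qed.

(** Grouping of independent families: finite intersections of sets taken from the F i with i in J
    form a pi-system generating the join over J, and on two such pi-systems the product rule is read
    off over the union of the index sets. *)
Lemma mutually_independent_indep (I : choiceType) (F : I -> set (set T))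
    (J1 J2 : set I) : (forall i, sub_sigma (F i)) -> mutually_independent P F ->
  [disjoint J1 & J2]%classic ->
  indep <<s \bigcup_(i in J1) F i >> <<s \bigcup_(i in J2) F i >>.
Proof.
move=> sF mF /disj_setPS J12.
(* Choices of sets are total functions equal to [setT] off K, so two of them can be compared over a
   common larger index set. *)
pose supp (K : {fset I}) (a : I -> set T) :=
  (forall i, F i (a i)) /\ (forall i, i \notin K -> a i = setT).
pose Pi J := [set A | exists (K : {fset I}) (a : I -> set T),
  [/\ supp K a, [set` K] `<=` J & A = \bigcap_i a i]].
have suppE K a : supp K a -> \bigcap_i a i = \bigcap_(i in [set` K]) a i.
  move=> [_ aT]; apply/seteqP; split=> t At i Ki; first exact: At.
  by have [/At//|/aT ->] := boolP (i \in K).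
have PE K a : supp K a -> P (\bigcap_i a i) = \prod_(i <- K) P (a i).
  by move=> Ka; rewrite (suppE K) //; apply: mF => i _; apply: Ka.1.
have suppS K K' a : (K `<=` K')%fset -> supp K a -> supp K' a.
  move=> KK' [Fa aT]; split=> // i; move=> iK'; apply: aT.
  by apply: contra iK'; apply/fsubsetP.
have supp_meas K a : supp K a -> measurable (\bigcap_i a i).
  move=> Ka; rewrite (suppE K) //.
  by apply: fin_bigcap_measurable => // i _; apply: (sF i).2; exact: Ka.1.
have PiM J : Pi J `<=` measurable.
  by move=> _ [K [a [Ka _ ->]]]; exact: supp_meas Ka.
have PiI J : setI_closed (Pi J).
  move=> _ _ [K [a [Ka KJ ->]]] [L [b [Lb LJ ->]]].
  exists (K `|` L)%fset, (fun i => a i `&` b i); split; last by rewrite bigcapI.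
    split=> [i|i]; first by apply: (sub_sigmaI (sF i)); [exact: Ka.1|exact: Lb.1].
    by rewrite in_fsetU negb_or => /andP[/Ka.2 -> /Lb.2 ->]; rewrite setIT.
  by move=> i /=; rewrite in_fsetU => /orP[/KJ|/LJ].
have sub J : <<s \bigcup_(i in J) F i >> `<=` <<s Pi J >>.
  apply: sub_smallest2r; first exact: smallest_sigma_algebra.
  move=> A [i Ji FA].
  exists [fset i]%fset, (fun j => if j == i then A else setT); split.
  - split=> j; first by case: eqP => [->//|_]; exact: sub_sigmaT.
    by rewrite in_fset1 => /negPf ->.
  - by move=> j /=; rewrite in_fset1 => /eqP ->.
  - apply/seteqP; split=> t; first by move=> At j _; case: eqP.
    by move=> /(_ i Logic.I); rewrite eqxx.
apply: (sub_indep (sub J1) (sub J2)); apply: indep_sigma2 => //.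
move=> _ _ [K [a [Ka KJ ->]]] [L [b [Lb LJ ->]]].
have Ka' := suppS _ (K `|` L)%fset _ (fsubsetUl _ _) Ka.
have Lb' := suppS _ (K `|` L)%fset _ (fsubsetUr _ _) Lb.
rewrite -bigcapI (PE _ _ Ka') (PE _ _ Lb') (PE (K `|` L)%fset); last first.
  split=> i; first by apply: (sub_sigmaI (sF i)); [exact: Ka.1|exact: Lb.1].
  by move=> iKL; rewrite Ka'.2 // Lb'.2 // setIT.
(* Since J1 and J2 are disjoint, at each index one of the two sets is [setT]. *)
rewrite -big_split /=; apply: eq_bigr => i _.
have [iK|/Ka.2 ->] := boolP (i \in K); last by rewrite setTI probability_setT mul1e.
have [iL|/Lb.2 ->] := boolP (i \in L); last by rewrite setIT probability_setT mule1.
by have [] := J12 i; split; [exact: KJ|exact: LJ].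
Qed.

End Independence.

(** * Expectation of a product *)

Section RealExpectation.
Context (d : measure_display) (T : measurableType d) (R : realType).
Context (P : probability T R).
Local Open Scope ereal_scope.

Lemma Lfun2D (f g : T -> R) : f \in Lfun P 2%:E -> g \in Lfun P 2%:E ->
  (fun t => f t + g t)%R \in Lfun P 2%:E.
Proof.
have h : 1 <= 2%:E :> \bar R by rewrite lee_fin ler1n.
exact: (Lfun_addr_closed P h).2.
Qed.

Lemma Lfun1_2 (f : T -> R) : f \in Lfun P 2%:E -> f \in Lfun P 1.
Proof. by apply: Lfun_subset12; exact: fin_num_measure. Qed.

Lemma Lfun_measurable p (f : T -> R) : f \in Lfun P p -> measurable_fun setT f.
Proof. by move=> /andP[/[!inE]]. Qed.

(** The joint law agrees with the product of the marginal laws on rectangles, hence everywhere.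
    Tonelli then makes the product integrable from the L^1 hypotheses alone, and Fubini factors its
    integral. *)
Lemma expectationM_RV (X Y : {RV P >-> R}) :
  (forall A B, measurable A -> measurable B ->
     P (X @^-1` A `&` Y @^-1` B) = P (X @^-1` A) * P (Y @^-1` B)) ->
  (X : T -> R) \in Lfun P 1 -> (Y : T -> R) \in Lfun P 1 ->
  (fun t => X t * Y t)%R \in Lfun P 1 /\
  'E_P[(fun t => X t * Y t)%R] = 'E_P[X] * 'E_P[Y].
Proof.
move=> iXY lX lY.
have iX := (Lfun1_integrable P X).1 lX.
have iY := (Lfun1_integrable P Y).1 lY.
pose m1 := distribution P X; pose m2 := distribution P Y.
have mXY : measurable_fun setT (fun t => (X t, Y t)).
  exact: measurable_fun_pair.
pose h : {RV P >-> (R * R)%type} := mfun_Sub (mem_set mXY : _ \in mfun).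
pose m' := distribution P h.
pose f : R * R -> \bar R := fun z => (z.1 * z.2)%:E.
have mf : measurable_fun [set: R * R] f.
  by apply/measurable_EFinP; apply: measurable_funM.
have m'E C : measurable C -> m' C = (m1 \x m2) C.
  by move=> mC; apply/esym; exact: product_measure_unique.
have nX : \int[m1]_x `|x%:E| = \int[P]_t `|(X t)%:E|.
  by rewrite ge0_integral_distribution //; exact: measurableT_comp.
have nY : \int[m2]_x `|x%:E| = \int[P]_t `|(Y t)%:E|.
  by rewrite ge0_integral_distribution //; exact: measurableT_comp.
have intf : (m1 \x m2).-integrable setT f.
  apply/integrable12ltyP => //.
  have nYoo : \int[m2]_y `|y%:E| < +oo by rewrite nY; case/integrableP: iY.
  have nXoo : \int[m1]_y `|y%:E| < +oo by rewrite nX; case/integrableP: iX.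
  rewrite (eq_integral (fun x : R => (\int[m2]_y `|y%:E|) * `|x%:E|)); last first.
    move=> x _; rewrite muleC -ge0_integralZl //.
      by apply: eq_integral => y _; rewrite /f /= normrM EFinM.
    by apply: measurableT_comp.
  rewrite ge0_integralZl //; last 2 first.
  - by apply: measurableT_comp.
  - exact: integral_ge0.
  by rewrite lte_mul_pinfty ?integral_ge0 // ge0_fin_numE ?integral_ge0.
have eqf (g : R * R -> \bar R) : \int[m']_z g z = \int[m1 \x m2]_z g z.
  by apply: eq_measure_integral => A mA _; exact: m'E.
have intP : P.-integrable setT (f \o h).
  apply/integrableP; split; first exact: measurableT_comp.
  have -> : \int[P]_t `|(f \o h) t| = \int[m']_z `|f z|.
    by rewrite ge0_integral_distribution //; apply: measurableT_comp.
  by rewrite eqf; case/integrableP: intf.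
split; first exact/Lfun1_integrable.
rewrite unlock.
have -> : \int[P]_t (X t * Y t)%:E = \int[m']_z f z.
  by rewrite integral_distribution.
rewrite eqf -integral12_prod_meas1 // /fubini_F.
have iY' : m2.-integrable setT EFin.
  by apply/integrableP; split=> //; rewrite nY; case/integrableP: iY.
have iX' : m1.-integrable setT EFin.
  by apply/integrableP; split=> //; rewrite nX; case/integrableP: iX.
rewrite (eq_integral (fun x : R => (\int[m2]_y y%:E) * x%:E)); last first.
  move=> x _; rewrite muleC -integralZl //.
have -> : \int[m2]_y y%:E = \int[P]_t (Y t)%:E by rewrite integral_distribution.
rewrite -(fineK (integrable_fin_num measurableT iY)) integralZl //.
by rewrite muleC integral_distribution.
Qed.

(** Measurability for a sub-sigma-algebra, phrased on the measurable type that G generates so that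
    closure of measurable functions under sums and products applies directly. *)
Definition gmeas (G : set (set T)) (f : T -> R) :=
  measurable_fun [set: g_sigma_algebraType G] (f : g_sigma_algebraType G -> R).

Lemma gmeasP (G : set (set T)) f : sub_sigma G ->
  gmeas G f <-> forall B, measurable B -> G (f @^-1` B).
Proof.
move=> [sG _]; have GE : <<s G >> = G by exact: smallest_id.
split=> [mf B mB|Gf _ B mB].
  by rewrite -GE -[X in smallest _ _ X]setTI; exact: mf.
by rewrite setTI /measurable /= GE; exact: Gf.
Qed.

Lemma expectationM_indep (F G : set (set T)) (X Y : T -> R) :
  sub_sigma F -> sub_sigma G -> indep P F G -> gmeas F X -> gmeas G Y ->
  X \in Lfun P 1 -> Y \in Lfun P 1 ->
  (fun t => X t * Y t)%R \in Lfun P 1 /\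
  'E_P[(fun t => X t * Y t)%R] = 'E_P[X] * 'E_P[Y].
Proof.
move=> sF sG FG /(gmeasP _ sF) FX /(gmeasP _ sG) GY lX lY.
have mX := Lfun_measurable lX; have mY := Lfun_measurable lY.
pose X' : {RV P >-> R} := mfun_Sub (mem_set mX : X \in mfun).
pose Y' : {RV P >-> R} := mfun_Sub (mem_set mY : Y \in mfun).
apply: (@expectationM_RV X' Y') => // A B mA mB.
by apply: FG; [exact: FX|exact: GY].
Qed.

End RealExpectation.

(** * Complex-valued random variables *)

Section ComplexExpectation.
Context (d : measure_display) (T : measurableType d) (R : realType).
Context (P : probability T R).
Local Notation C := R[i].
Local Open Scope complex_scope.
Local Open Scope sesquilinear_scope.
Implicit Types f g : T -> C.

Definition LpC (p : \bar R) f :=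
  (fun t => complex.Re (f t)) \in Lfun P p /\
  (fun t => complex.Im (f t)) \in Lfun P p.

Definition expC f : C :=
  fine ('E_P[fun t => complex.Re (f t)]) +i* fine ('E_P[fun t => complex.Im (f t)]).

Definition gmeasC (G : set (set T)) f :=
  gmeas G (fun t => complex.Re (f t)) /\ gmeas G (fun t => complex.Im (f t)).

Lemma eq_Lfun p (f g : T -> R) : f \in Lfun P p -> g =1 f -> g \in Lfun P p.
Proof. by move=> lf /funext ->. Qed.

Lemma Lfun1D (f g : T -> R) : f \in Lfun P 1 -> g \in Lfun P 1 ->
  (fun t => f t + g t) \in Lfun P 1.
Proof. exact: rpredD. Qed.

Lemma Lfun1B (f g : T -> R) : f \in Lfun P 1 -> g \in Lfun P 1 ->
  (fun t => f t - g t) \in Lfun P 1.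
Proof. exact: rpredB. Qed.

Lemma Lfun1Z (a : R) (f : T -> R) : f \in Lfun P 1 ->
  (fun t => a * f t) \in Lfun P 1.
Proof.
move=> lf; apply: eq_Lfun (@Lfun_scale _ _ _ P f a 1 (lexx 1) lf) _ => t /=.
by rewrite mulrC.
Qed.

Lemma fine_expectationD (f g : T -> R) : f \in Lfun P 1 -> g \in Lfun P 1 ->
  fine 'E_P[fun t => f t + g t] = fine 'E_P[f] + fine 'E_P[g].
Proof.
by move=> lf lg; rewrite -fineD ?expectation_fin_num // -expectationD.
Qed.

Lemma fine_expectationB (f g : T -> R) : f \in Lfun P 1 -> g \in Lfun P 1 ->
  fine 'E_P[fun t => f t - g t] = fine 'E_P[f] - fine 'E_P[g].
Proof.
by move=> lf lg; rewrite -fineB ?expectation_fin_num // -expectationB.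
Qed.

Lemma fine_expectationZ (a : R) (f : T -> R) : f \in Lfun P 1 ->
  fine 'E_P[fun t => a * f t] = a * fine 'E_P[f].
Proof.
move=> lf; rewrite -[a in RHS]/(fine a%:E) -fineM ?expectation_fin_num //.
rewrite -expectationZl //; congr (fine 'E_P[_]).
by apply/funext => t /=; rewrite mulrC.
Qed.

Lemma fine_expectationM (F G : set (set T)) (f g : T -> R) :
  sub_sigma F -> sub_sigma G -> indep P F G -> gmeas F f -> gmeas G g ->
  f \in Lfun P 1 -> g \in Lfun P 1 ->
  (fun t => f t * g t) \in Lfun P 1 /\
  fine 'E_P[fun t => f t * g t] = fine 'E_P[f] * fine 'E_P[g].
Proof.
move=> sF sG FG Ff Gg lf lg.
have [lfg ->] := expectationM_indep sF sG FG Ff Gg lf lg.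
by split=> //; rewrite fineM ?expectation_fin_num.
Qed.

Lemma LpC12 f : LpC 2%:E f -> LpC 1 f.
Proof. by case=> fR fI; split; exact: Lfun1_2. Qed.

Lemma LpC1D f g : LpC 1 f -> LpC 1 g -> LpC 1 (fun t => f t + g t).
Proof.
move=> [fR fI] [gR gI]; split.
  apply: eq_Lfun (Lfun1D fR gR) _ => t.
  by case: (f t) (g t) => [? ?] [? ?].
apply: eq_Lfun (Lfun1D fI gI) _ => t.
by case: (f t) (g t) => [? ?] [? ?].
Qed.

Lemma LpC2D f g : LpC 2%:E f -> LpC 2%:E g -> LpC 2%:E (fun t => f t + g t).
Proof.
move=> [fR fI] [gR gI]; split.
  apply: eq_Lfun (Lfun2D fR gR) _ => t.
  by case: (f t) (g t) => [? ?] [? ?].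
apply: eq_Lfun (Lfun2D fI gI) _ => t.
by case: (f t) (g t) => [? ?] [? ?].
Qed.

Lemma expCD f g : LpC 1 f -> LpC 1 g ->
  expC (fun t => f t + g t) = expC f + expC g.
Proof.
move=> [fR fI] [gR gI]; rewrite /expC; simpc.
rewrite -fine_expectationD // -fine_expectationD //.
by congr (fine 'E_P[_] +i* fine 'E_P[_]); apply/funext => t;
  case: (f t) (g t) => [? ?] [? ?].
Qed.

Lemma LpC_cst c : LpC 1 (fun=> c).
Proof. by split; exact: Lfun_cst. Qed.

Lemma expC_cst c : expC (fun=> c) = c.
Proof. by rewrite /expC !expectation_cst /=; case: c. Qed.

Lemma mulcE (x y : C) : x * y =
  (complex.Re x * complex.Re y - complex.Im x * complex.Im y) +i*
  (complex.Re x * complex.Im y + complex.Im x * complex.Re y).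
Proof. by case: x y => [? ?] [? ?]. Qed.

Lemma LpC1Z a f : LpC 1 f -> LpC 1 (fun t => a * f t).
Proof.
move=> [fR fI]; split.
  apply: eq_Lfun (Lfun1B (Lfun1Z (complex.Re a) fR) (Lfun1Z (complex.Im a) fI)) _ => t.
  by rewrite mulcE.
apply: eq_Lfun (Lfun1D (Lfun1Z (complex.Re a) fI) (Lfun1Z (complex.Im a) fR)) _ => t.
by rewrite mulcE.
Qed.

Lemma expCZ a f : LpC 1 f -> expC (fun t => a * f t) = a * expC f.
Proof.
move=> [fR fI]; rewrite mulcE /= -!fine_expectationZ //.
rewrite -fine_expectationB ?Lfun1Z // -fine_expectationD ?Lfun1Z //.
by congr (fine 'E_P[_] +i* fine 'E_P[_]); apply/funext => t; rewrite mulcE.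
Qed.

Lemma LpC1_sum (I : Type) (r : seq I) (Q : pred I) (f : I -> T -> C) :
  (forall i, Q i -> LpC 1 (f i)) -> LpC 1 (fun t => \sum_(i <- r | Q i) f i t).
Proof.
move=> lf; elim: r => [|i r IH].
  under eq_fun => t do rewrite big_nil.
  exact: LpC_cst.
under eq_fun => t do rewrite big_cons.
case Qi: (Q i) => //; apply: LpC1D => //; exact: lf.
Qed.

Lemma expC_sum (I : Type) (r : seq I) (Q : pred I) (f : I -> T -> C) :
  (forall i, Q i -> LpC 1 (f i)) ->
  expC (fun t => \sum_(i <- r | Q i) f i t) = \sum_(i <- r | Q i) expC (f i).
Proof.
move=> lf; elim: r => [|i r IH].
  under eq_fun => t do rewrite big_nil.
  by rewrite expC_cst big_nil.
under eq_fun => t do rewrite big_cons.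
rewrite big_cons; case: ifP => // Qi.
by rewrite expCD ?IH //; [exact: lf|exact: LpC1_sum].
Qed.

Lemma conjCE (x : C) : Num.conj x = complex.Re x -i* complex.Im x.
Proof. by case: x. Qed.

Lemma LfunN p (f : T -> R) : f \in Lfun P p -> (fun t => - f t) \in Lfun P p.
Proof. by move=> lf; exact: Lfun_oppr_closed lf. Qed.

Lemma LpC_conj p f : LpC p f -> LpC p (fun t => Num.conj (f t)).
Proof.
move=> [fR fI]; split.
  by apply: eq_Lfun fR _ => t; rewrite conjCE.
apply: eq_Lfun (LfunN fI) _ => t.
by rewrite conjCE.
Qed.

Lemma expC_conj f : LpC 1 f -> expC (fun t => Num.conj (f t)) = Num.conj (expC f).
Proof.
move=> [fR fI]; rewrite conjCE /= -mulN1r -fine_expectationZ //.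
by congr (fine 'E_P[_] +i* fine 'E_P[_]); apply/funext => t;
  rewrite conjCE //= mulN1r.
Qed.

Lemma LpC2M f g : LpC 2%:E f -> LpC 2%:E g -> LpC 1 (fun t => f t * g t).
Proof.
move=> [fR fI] [gR gI]; split.
  apply: eq_Lfun (Lfun1B (Lfun2_mul_Lfun1 fR gR) (Lfun2_mul_Lfun1 fI gI)) _ => t.
  by rewrite mulcE.
apply: eq_Lfun (Lfun1D (Lfun2_mul_Lfun1 fR gI) (Lfun2_mul_Lfun1 fI gR)) _ => t.
by rewrite mulcE.
Qed.

(** The complex product is split into four real products, each of which factors. *)
Lemma expCM (F G : set (set T)) f g :
  sub_sigma F -> sub_sigma G -> indep P F G -> gmeasC F f -> gmeasC G g ->
  LpC 1 f -> LpC 1 g ->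
  LpC 1 (fun t => f t * g t) /\ expC (fun t => f t * g t) = expC f * expC g.
Proof.
move=> sF sG FG [FR FI] [GR GI] [fR fI] [gR gI].
have [lRR eRR] := fine_expectationM sF sG FG FR GR fR gR.
have [lRI eRI] := fine_expectationM sF sG FG FR GI fR gI.
have [lIR eIR] := fine_expectationM sF sG FG FI GR fI gR.
have [lII eII] := fine_expectationM sF sG FG FI GI fI gI.
split; first split.
- apply: eq_Lfun (Lfun1B lRR lII) _ => t.
  by rewrite mulcE.
- apply: eq_Lfun (Lfun1D lRI lIR) _ => t.
  by rewrite mulcE.
rewrite mulcE /= -eRR -eII -eRI -eIR -fine_expectationB // -fine_expectationD //.
by congr (fine 'E_P[_] +i* fine 'E_P[_]); apply/funext => t; rewrite mulcE.
Qed.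

Lemma gmeasCD G f g : gmeasC G f -> gmeasC G g -> gmeasC G (fun t => f t + g t).
Proof.
move=> [fR fI] [gR gI]; split.
  apply: eq_measurable_fun (measurable_funD fR gR) => t _.
  by rewrite /=; case: (f t) (g t) => [? ?] [? ?].
apply: eq_measurable_fun (measurable_funD fI gI) => t _.
by rewrite /=; case: (f t) (g t) => [? ?] [? ?].
Qed.

Lemma gmeasCM G f g : gmeasC G f -> gmeasC G g -> gmeasC G (fun t => f t * g t).
Proof.
move=> [fR fI] [gR gI]; split.
  apply: eq_measurable_fun (measurable_funB (measurable_funM fR gR)
    (measurable_funM fI gI)) => t _.
  by rewrite /= mulcE.
apply: eq_measurable_fun (measurable_funD (measurable_funM fR gI)
  (measurable_funM fI gR)) => t _.
by rewrite /= mulcE.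
Qed.

Lemma gmeasC_cst G c : gmeasC G (fun=> c).
Proof. by split; exact: measurable_cst. Qed.

Lemma gmeasC_conj G f : gmeasC G f -> gmeasC G (fun t => Num.conj (f t)).
Proof.
move=> [fR fI]; split.
  by apply: eq_measurable_fun fR => t _; rewrite conjCE.
apply: eq_measurable_fun (measurableT_comp (@oppr_measurable R setT) fI) => t _.
by rewrite conjCE.
Qed.

Lemma gmeasC_sum (I : Type) (r : seq I) (Q : pred I) G (f : I -> T -> C) :
  (forall i, Q i -> gmeasC G (f i)) ->
  gmeasC G (fun t => \sum_(i <- r | Q i) f i t).
Proof.
move=> lf; elim: r => [|i r IH].
  under eq_fun => t do rewrite big_nil.
  exact: gmeasC_cst.
under eq_fun => t do rewrite big_cons.
case Qi: (Q i) => //; apply: gmeasCD => //; exact: lf.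
Qed.

Lemma sub_gmeas (F G : set (set T)) (f : T -> R) : F `<=` G ->
  gmeas F f -> gmeas G f.
Proof.
move=> FG mf _ B mB; have := mf measurableT B mB.
by apply: sub_smallest2r; [exact: smallest_sigma_algebra|].
Qed.

End ComplexExpectation.

(** * Expectation of random matrices *)

Section RandomMatrixCalculus.
Context (d : measure_display) (T : measurableType d) (R : realType).
Context (P : probability T R).
Local Notation C := R[i].
Local Open Scope complex_scope.
Local Open Scope sesquilinear_scope.

Definition mxmeas (G : set (set T)) m n (X : T -> 'M[C]_(m, n)) :=
  forall i j, gmeasC G (fun t => X t i j).

Lemma expMxE m n (X : T -> 'M[C]_(m, n)) i j :
  expMx P X i j = expC P (fun t => X t i j).
Proof. by rewrite mxE. Qed.

Lemma LpMx12 m n (X : T -> 'M[C]_(m, n)) : LpMx P 2%:E X -> LpMx P 1 X.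
Proof. by move=> lX i j; apply: LpC12; exact: lX. Qed.

Lemma LpMx1D m n (X Y : T -> 'M[C]_(m, n)) : LpMx P 1 X -> LpMx P 1 Y ->
  LpMx P 1 (fun t => X t + Y t).
Proof.
move=> lX lY i j; rewrite -/(LpC P 1 (fun t => (X t + Y t) i j)).
by under eq_fun do rewrite mxE; apply: LpC1D; [exact: lX|exact: lY].
Qed.

Lemma LpMx2D m n (X Y : T -> 'M[C]_(m, n)) : LpMx P 2%:E X -> LpMx P 2%:E Y ->
  LpMx P 2%:E (fun t => X t + Y t).
Proof.
move=> lX lY i j; rewrite -/(LpC P 2%:E (fun t => (X t + Y t) i j)).
by under eq_fun do rewrite mxE; apply: LpC2D; [exact: lX|exact: lY].
Qed.

Lemma expMxD m n (X Y : T -> 'M[C]_(m, n)) : LpMx P 1 X -> LpMx P 1 Y ->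
  expMx P (fun t => X t + Y t) = expMx P X + expMx P Y.
Proof.
move=> lX lY; apply/matrixP => i j; rewrite [RHS]mxE !expMxE.
by under eq_fun do rewrite mxE; apply: expCD; [exact: lX|exact: lY].
Qed.

Lemma LpMx_cst m n (A : 'M[C]_(m, n)) : LpMx P 1 (fun=> A).
Proof. by move=> i j; exact: LpC_cst. Qed.

Lemma expMx_cst m n (A : 'M[C]_(m, n)) : expMx P (fun=> A) = A.
Proof. by apply/matrixP => i j; rewrite expMxE expC_cst. Qed.

Lemma LpMx1Z m n a (X : T -> 'M[C]_(m, n)) : LpMx P 1 X ->
  LpMx P 1 (fun t => a *: X t).
Proof.
move=> lX i j; rewrite -/(LpC P 1 (fun t => (a *: X t) i j)).
by under eq_fun do rewrite mxE; apply: LpC1Z; exact: lX.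
Qed.

Lemma expMxZ m n a (X : T -> 'M[C]_(m, n)) : LpMx P 1 X ->
  expMx P (fun t => a *: X t) = a *: expMx P X.
Proof.
move=> lX; apply/matrixP => i j; rewrite [RHS]mxE !expMxE.
by under eq_fun do rewrite mxE; apply: expCZ; exact: lX.
Qed.

Lemma LpMx1B m n (X Y : T -> 'M[C]_(m, n)) : LpMx P 1 X -> LpMx P 1 Y ->
  LpMx P 1 (fun t => X t - Y t).
Proof.
move=> lX lY; under eq_fun do rewrite -scaleN1r.
by apply: LpMx1D => //; exact: LpMx1Z.
Qed.

Lemma expMxB m n (X Y : T -> 'M[C]_(m, n)) : LpMx P 1 X -> LpMx P 1 Y ->
  expMx P (fun t => X t - Y t) = expMx P X - expMx P Y.
Proof.
move=> lX lY; under eq_fun do rewrite -scaleN1r.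
by rewrite expMxD ?expMxZ ?scaleN1r //; exact: LpMx1Z.
Qed.

Lemma LpMx1_sum (I : Type) (r : seq I) (Q : pred I) m n
    (X : I -> T -> 'M[C]_(m, n)) : (forall i, Q i -> LpMx P 1 (X i)) ->
  LpMx P 1 (fun t => \sum_(i <- r | Q i) X i t).
Proof.
move=> lX a b; rewrite -/(LpC P 1 (fun t => (\sum_(i <- r | Q i) X i t) a b)).
under eq_fun do rewrite summxE.
by apply: LpC1_sum => i Qi; exact: lX.
Qed.

Lemma expMx_sum (I : Type) (r : seq I) (Q : pred I) m n
    (X : I -> T -> 'M[C]_(m, n)) : (forall i, Q i -> LpMx P 1 (X i)) ->
  expMx P (fun t => \sum_(i <- r | Q i) X i t) = \sum_(i <- r | Q i) expMx P (X i).
Proof.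
move=> lX; apply/matrixP => a b; rewrite expMxE summxE.
under eq_fun do rewrite summxE.
rewrite expC_sum => [|i Qi]; last exact: lX.
by apply: eq_bigr => i _; rewrite expMxE.
Qed.

Lemma LpMx1_mulr m n p (X : T -> 'M[C]_(m, n)) (A : 'M[C]_(n, p)) :
  LpMx P 1 X -> LpMx P 1 (fun t => X t *m A).
Proof.
move=> lX i j; rewrite -/(LpC P 1 (fun t => (X t *m A) i j)).
under eq_fun do (rewrite mxE; under eq_bigr do rewrite mulrC).
by apply: LpC1_sum => k _; apply: LpC1Z; exact: lX.
Qed.

Lemma expMx_mulr m n p (X : T -> 'M[C]_(m, n)) (A : 'M[C]_(n, p)) :
  LpMx P 1 X -> expMx P (fun t => X t *m A) = expMx P X *m A.
Proof.
move=> lX; apply/matrixP => i j; rewrite expMxE mxE.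
under eq_fun do (rewrite mxE; under eq_bigr do rewrite mulrC).
rewrite expC_sum => [|k _]; last by apply: LpC1Z; exact: lX.
apply: eq_bigr => k _; rewrite expCZ ?expMxE 1?mulrC //; exact: lX.
Qed.

Lemma LpMx_adj p m n (X : T -> 'M[C]_(m, n)) :
  LpMx P p X -> LpMx P p (fun t => (X t)^t*).
Proof.
move=> lX i j; rewrite -/(LpC P p (fun t => ((X t)^t*) i j)).
under eq_fun do rewrite !mxE.
by apply: LpC_conj; exact: lX.
Qed.

Lemma expMx_adj m n (X : T -> 'M[C]_(m, n)) :
  LpMx P 1 X -> expMx P (fun t => (X t)^t*) = (expMx P X)^t*.
Proof.
move=> lX; apply/matrixP => i j; rewrite expMxE [RHS]mxE mxE expMxE.
by under eq_fun do rewrite !mxE; rewrite expC_conj //; exact: lX.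
Qed.

Lemma LpMx2M m n p (X : T -> 'M[C]_(m, n)) (Y : T -> 'M[C]_(n, p)) :
  LpMx P 2%:E X -> LpMx P 2%:E Y -> LpMx P 1 (fun t => X t *m Y t).
Proof.
move=> lX lY i j; rewrite -/(LpC P 1 (fun t => (X t *m Y t) i j)).
under eq_fun do rewrite mxE.
by apply: LpC1_sum => k _; apply: LpC2M; [exact: lX|exact: lY].
Qed.

(** Meant for factors that are merely integrable, such as phi; integrability of the product is
    therefore part of the conclusion. *)
Lemma expMxM (F G : set (set T)) m n p (X : T -> 'M[C]_(m, n))
    (Y : T -> 'M[C]_(n, p)) :
  sub_sigma F -> sub_sigma G -> indep P F G -> mxmeas F X -> mxmeas G Y ->
  LpMx P 1 X -> LpMx P 1 Y ->
  LpMx P 1 (fun t => X t *m Y t) /\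
  expMx P (fun t => X t *m Y t) = expMx P X *m expMx P Y.
Proof.
move=> sF sG FG mX mY lX lY.
have H i k j := expCM sF sG FG (mX i k) (mY k j) (lX i k) (lY k j).
split=> [i j|].
  rewrite -/(LpC P 1 (fun t => (X t *m Y t) i j)).
  by under eq_fun do rewrite mxE; apply: LpC1_sum => k _; case: (H i k j).
apply/matrixP => i j; rewrite expMxE mxE.
under eq_fun do rewrite mxE.
rewrite expC_sum => [|k _]; last by case: (H i k j).
by apply: eq_bigr => k _; rewrite (H i k j).2 !expMxE.
Qed.

Lemma mxmeasD G m n (X Y : T -> 'M[C]_(m, n)) : mxmeas G X -> mxmeas G Y ->
  mxmeas G (fun t => X t + Y t).
Proof.
move=> mX mY i j; under eq_fun do rewrite mxE.
by apply: gmeasCD; [exact: mX|exact: mY].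
Qed.

Lemma mxmeas_cst G m n (A : 'M[C]_(m, n)) : mxmeas G (fun=> A).
Proof. by move=> i j; exact: gmeasC_cst. Qed.

Lemma mxmeasM G m n p (X : T -> 'M[C]_(m, n)) (Y : T -> 'M[C]_(n, p)) :
  mxmeas G X -> mxmeas G Y -> mxmeas G (fun t => X t *m Y t).
Proof.
move=> mX mY i j; under eq_fun do rewrite mxE.
by apply: gmeasC_sum => k _; apply: gmeasCM; [exact: mX|exact: mY].
Qed.

Lemma mxmeasZ G m n a (X : T -> 'M[C]_(m, n)) : mxmeas G X ->
  mxmeas G (fun t => a *: X t).
Proof.
move=> mX; under eq_fun do rewrite -mul_scalar_mx.
by apply: mxmeasM => //; exact: mxmeas_cst.
Qed.

Lemma mxmeasB G m n (X Y : T -> 'M[C]_(m, n)) : mxmeas G X -> mxmeas G Y ->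
  mxmeas G (fun t => X t - Y t).
Proof.
move=> mX mY; under eq_fun do rewrite -scaleN1r.
by apply: mxmeasD => //; exact: mxmeasZ.
Qed.

Lemma mxmeas_sum (I : Type) (r : seq I) (Q : pred I) G m n
    (X : I -> T -> 'M[C]_(m, n)) : (forall i, Q i -> mxmeas G (X i)) ->
  mxmeas G (fun t => \sum_(i <- r | Q i) X i t).
Proof.
move=> mX a b; under eq_fun do rewrite summxE.
by apply: gmeasC_sum => i Qi; exact: mX.
Qed.

Lemma mxmeas_adj G m n (X : T -> 'M[C]_(m, n)) : mxmeas G X ->
  mxmeas G (fun t => (X t)^t*).
Proof.
by move=> mX i j; under eq_fun do rewrite !mxE; apply: gmeasC_conj; exact: mX.
Qed.

Lemma sub_mxmeas (F G : set (set T)) m n (X : T -> 'M[C]_(m, n)) :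
  F `<=` G -> mxmeas F X -> mxmeas G X.
Proof.
by move=> FG mX i j; have [mR mI] := mX i j; split; exact: sub_gmeas FG _.
Qed.

Lemma sub_sigma_mx p m n (X : T -> 'M[C]_(m, n)) : LpMx P p X ->
  sub_sigma (sigma_mx X).
Proof.
move=> lX; apply: sub_sigma_gen => A [i [j [B [mB AE]]]].
have [/Lfun_measurable mR /Lfun_measurable mI] := lX i j.
by case: AE => ->; rewrite -[X in measurable X]setTI; [exact: mR|exact: mI].
Qed.

Lemma mxmeas_sigma_mx p m n (X : T -> 'M[C]_(m, n)) : LpMx P p X ->
  mxmeas (sigma_mx X) X.
Proof.
move=> /sub_sigma_mx sX i j.
by split; apply/gmeasP => // B mB; apply: sub_gen_smallest;
  exists i, j, B; split=> //; [left|right].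
Qed.

Lemma sub_sigma_join (I : Type) (F : I -> set (set T)) :
  (forall i, sub_sigma (F i)) -> sub_sigma (sigma_join F).
Proof. by move=> sF; apply: sub_sigma_gen => A [i _ FA]; exact: (sF i).2. Qed.

Lemma sigma_join_sup (I : Type) (F : I -> set (set T)) i : F i `<=` sigma_join F.
Proof. by move=> A FA; apply: sub_gen_smallest; exists i. Qed.

End RandomMatrixCalculus.

(** * Past and fresh signals *)

Section JoinedSigmas.
Context (d : measure_display) (T : measurableType d) (R : realType).
Context (P : probability T R).
Implicit Types F G H : set (set T).

Definition join2 F G := <<s F `|` G >>.

Lemma sub_sigma_join2 F G : sub_sigma F -> sub_sigma G -> sub_sigma (join2 F G).
Proof. by move=> sF sG; apply: sub_sigma_gen => A [/sF.2|/sG.2]. Qed.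

Lemma join2_l F G : F `<=` join2 F G.
Proof. by move=> A FA; apply: sub_gen_smallest; left. Qed.

Lemma join2_r F G : G `<=` join2 F G.
Proof. by move=> A GA; apply: sub_gen_smallest; right. Qed.

Lemma join2_sub F G H : sub_sigma H -> F `<=` H -> G `<=` H -> join2 F G `<=` H.
Proof. by move=> sH FH GH; apply: smallest_sub; [exact: sH.1|move=> A [/FH|/GH]]. Qed.

Definition joinset (I : Type) (F : I -> set (set T)) (J : set I) :=
  <<s \bigcup_(i in J) F i >>.

Lemma sub_sigma_joinset (I : Type) (F : I -> set (set T)) J :
  (forall i, sub_sigma (F i)) -> sub_sigma (joinset F J).
Proof. by move=> sF; apply: sub_sigma_gen => A [i _ FA]; exact: (sF i).2. Qed.

Lemma joinset_sup (I : Type) (F : I -> set (set T)) (J : set I) i : J i ->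
  F i `<=` joinset F J.
Proof. by move=> Ji A FA; apply: sub_gen_smallest; exists i. Qed.

Lemma sub_joinset (I : Type) (F : I -> set (set T)) (J K : set I) : J `<=` K ->
  joinset F J `<=` joinset F K.
Proof.
move=> JK; apply: sub_smallest2r; first exact: smallest_sigma_algebra.
by move=> A [i Ji FA]; exists i => //; exact: JK.
Qed.

Lemma joinset_join (I : Type) (F : I -> set (set T)) (J : set I) :
  joinset F J `<=` sigma_join F.
Proof.
apply: sub_smallest2r; first exact: smallest_sigma_algebra.
by move=> A [i Ji FA]; exists i.
Qed.

Lemma mutually_independent_pair (I : choiceType) (F : I -> set (set T)) i j :
  (forall i, sub_sigma (F i)) -> mutually_independent P F -> i != j ->
  indep P (F i) (F j).
Proof.
move=> sF mF ij.
apply: (sub_indep (F := joinset F [set i]) (G := joinset F [set j])).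
- exact: joinset_sup.
- exact: joinset_sup.
apply: mutually_independent_indep => //; apply/disj_setPS => k [/= -> ji].
by rewrite ji eqxx in ij.
Qed.

(** Regroups four sigma-algebras. In the application 1 stands for u, 2 for vu, F for the present and
    G for the past: independence over time within each signal and independence between the signals
    give independence of present and past. *)
Lemma indep_join2 F1 G1 F2 G2 : sub_sigma F1 -> sub_sigma G1 -> sub_sigma F2 ->
  sub_sigma G2 -> indep P F1 G1 -> indep P F2 G2 ->
  indep P (join2 F1 G1) (join2 F2 G2) -> indep P (join2 F1 F2) (join2 G1 G2).
Proof.
move=> sF1 sG1 sF2 sG2 i1 i2 i12.
have s1 := sub_sigma_join2 sF1 sG1; have s2 := sub_sigma_join2 sF2 sG2.
apply: indep_joinr => //; first exact: sub_sigma_join2.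
  apply/indepC/indep_joinr => //; first exact/indepC.
  apply: sub_indep i12; last exact: join2_l.
  by apply: join2_sub => //; [exact: join2_r|exact: join2_l].
apply: (sub_indep (F := join2 F2 (join2 F1 G1)) (G := G2)) => //.
  have s3 := sub_sigma_join2 sF2 s1.
  apply: join2_sub => //.
    apply: join2_sub => //; last exact: join2_l.
    by apply: subset_trans (@join2_r F2 _); exact: join2_l.
  by apply: subset_trans (@join2_r F2 _); exact: join2_r.
apply/indepC/indep_joinr => //; first exact/indepC.
apply/indepC; apply: sub_indep i12 => //.
by apply: join2_sub => //; [exact: join2_r|exact: join2_l].
Qed.

End JoinedSigmas.

(** * Measurability of the signals and estimates *)

Section SignalSigmas.
Context (d : measure_display) (T : measurableType d) (R : realType).
Context (P : probability T R) (N M : nat) (S : diffusion T R N M).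
Hypothesis hstat : statistics_ok P S.

Lemma sub_sigma_u x : sub_sigma (sigma_u S x).
Proof. exact: sub_sigma_mx (u_L2 hstat _ _). Qed.
Lemma sub_sigma_v x : sub_sigma (sigma_v S x).
Proof. exact: sub_sigma_mx (v_L2 hstat _ _). Qed.
Lemma sub_sigma_vw x : sub_sigma (sigma_vw S x).
Proof. exact: sub_sigma_mx (vw_L2 hstat _ _ _). Qed.
Lemma sub_sigma_vd x : sub_sigma (sigma_vd S x).
Proof. exact: sub_sigma_mx (vd_L2 hstat _ _ _). Qed.
Lemma sub_sigma_vu x : sub_sigma (sigma_vu S x).
Proof. exact: sub_sigma_mx (vu_L2 hstat _ _ _). Qed.
Lemma sub_sigma_vpsi x : sub_sigma (sigma_vpsi S x).
Proof. exact: sub_sigma_mx (vpsi_L2 hstat _ _ _). Qed.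

Lemma sub_sigma_init : sub_sigma (sigma_init S).
Proof. by apply: sub_sigma_join => k; exact: sub_sigma_mx (winit_L1 hstat k). Qed.

Lemma sub_sigma_families i : sub_sigma (sigma_families S i).
Proof.
case: i => -[|[|[|[|[|[|//]]]]]] i6; apply: sub_sigma_join.
- exact: sub_sigma_u.
- exact: sub_sigma_v.
- exact: sub_sigma_vw.
- exact: sub_sigma_vd.
- exact: sub_sigma_vu.
- exact: sub_sigma_vpsi.
Qed.

Definition fam_u : 'I_6 := @Ordinal 6 0 isT.
Definition fam_v : 'I_6 := @Ordinal 6 1 isT.
Definition fam_vw : 'I_6 := @Ordinal 6 2 isT.
Definition fam_vd : 'I_6 := @Ordinal 6 3 isT.
Definition fam_vu : 'I_6 := @Ordinal 6 4 isT.
Definition fam_vpsi : 'I_6 := @Ordinal 6 5 isT.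

Lemma mxmeas_u k i : mxmeas (sigma_u S (k, i)) (u S k i).
Proof. exact: mxmeas_sigma_mx (u_L2 hstat k i). Qed.
Lemma mxmeas_v k i : mxmeas (sigma_families S fam_v) (v S k i).
Proof.
apply: sub_mxmeas (mxmeas_sigma_mx (v_L2 hstat k i)).
exact: (@sigma_join_sup _ _ _ (sigma_v S) (k, i)).
Qed.
Lemma mxmeas_vw l k i : mxmeas (sigma_families S fam_vw) (vw S l k i).
Proof.
apply: sub_mxmeas (mxmeas_sigma_mx (vw_L2 hstat l k i)).
exact: (@sigma_join_sup _ _ _ (sigma_vw S) (l, k, i)).
Qed.
Lemma mxmeas_vd l k i : mxmeas (sigma_families S fam_vd) (vd S l k i).
Proof.
apply: sub_mxmeas (mxmeas_sigma_mx (vd_L2 hstat l k i)).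
exact: (@sigma_join_sup _ _ _ (sigma_vd S) (l, k, i)).
Qed.
Lemma mxmeas_vu l k i : mxmeas (sigma_vu S (l, k, i)) (vu S l k i).
Proof. exact: mxmeas_sigma_mx (vu_L2 hstat l k i). Qed.
Lemma mxmeas_vpsi l k i : mxmeas (sigma_families S fam_vpsi) (vpsi S l k i).
Proof.
apply: sub_mxmeas (mxmeas_sigma_mx (vpsi_L2 hstat l k i)).
exact: (@sigma_join_sup _ _ _ (sigma_vpsi S) (l, k, i)).
Qed.
Lemma mxmeas_fu k i : mxmeas (sigma_families S fam_u) (u S k i).
Proof.
by apply: sub_mxmeas (mxmeas_u k i); exact: (@sigma_join_sup _ _ _ (sigma_u S)).
Qed.
Lemma mxmeas_fvu l k i : mxmeas (sigma_families S fam_vu) (vu S l k i).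
Proof.
apply: sub_mxmeas (mxmeas_vu l k i).
exact: (@sigma_join_sup _ _ _ (sigma_vu S)).
Qed.

Lemma indep_families (i j : 'I_6) : i != j ->
  indep P (sigma_families S i) (sigma_families S j).
Proof.
exact: mutually_independent_pair sub_sigma_families (families_indep hstat).
Qed.

Definition before (I : Type) (n : nat) : set (I * nat) := [set x | (x.2 < n)%N].
Definition now (I : Type) (n : nat) : set (I * nat) := [set x | x.2 = n].
Arguments before {I}. Arguments now {I}.

Definition fresh n :=
  join2 (joinset (sigma_u S) (now n)) (joinset (sigma_vu S) (now n)).

Definition others := joinset (sigma_families S) [set i | i != fam_u /\ i != fam_vu].

(* Contains all that w_{.,n-1} and phi_{.,n-1} depend on; the families other than
   u and vu may be taken at all times, since [fresh n] does not involve them. *)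
Definition past n :=
  join2 (join2 (join2 (joinset (sigma_u S) (before n))
                      (joinset (sigma_vu S) (before n))) others) (sigma_init S).

Lemma sub_sigma_fresh n : sub_sigma (fresh n).
Proof.
apply: sub_sigma_join2; apply: sub_sigma_joinset.
  exact: sub_sigma_u.
exact: sub_sigma_vu.
Qed.

Lemma sub_sigma_before n : sub_sigma (join2 (joinset (sigma_u S) (before n))
  (joinset (sigma_vu S) (before n))).
Proof.
apply: sub_sigma_join2; apply: sub_sigma_joinset.
  exact: sub_sigma_u.
exact: sub_sigma_vu.
Qed.

Lemma sub_sigma_others : sub_sigma others.
Proof. exact: sub_sigma_joinset sub_sigma_families. Qed.

Lemma sub_sigma_past n : sub_sigma (past n).
Proof.
apply: sub_sigma_join2 sub_sigma_init.
exact: sub_sigma_join2 (sub_sigma_before n) sub_sigma_others.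
Qed.

(** The three joins that build [past] are added one at a time: earlier u and vu by whiteness, the
    other noise families by their independence from u and vu, and the initial estimates by their
    independence from all signals. *)
Lemma fresh_past_indep n : indep P (fresh n) (past n).
Proof.
have su := sub_sigma_u; have svu := sub_sigma_vu.
have sfu : sub_sigma (sigma_join (sigma_u S)) by exact: sub_sigma_join.
have sfvu : sub_sigma (sigma_join (sigma_vu S)) by exact: sub_sigma_join.
have disj (I : Type) : [disjoint (now n : set (I * nat)) & (before n)]%classic.
  by apply/disj_setPS => -[i m] [] /=; rewrite /now /before /= => ->; rewrite ltnn.
have i1 : indep P (fresh n) (join2 (joinset (sigma_u S) (before n))
    (joinset (sigma_vu S) (before n))).
  apply: indep_join2; try exact: sub_sigma_joinset.
  - exact: mutually_independent_indep (u_white hstat) (disj _).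
  - exact: mutually_independent_indep (vu_white hstat) (disj _).
  - apply: sub_indep (@indep_families fam_u fam_vu isT);
      by apply: join2_sub => //; exact: joinset_join.
(* This contains u and vu at all times, hence both the fresh signals and the earlier ones; against
   [others] it is a grouping of the six families. *)
pose uvu := joinset (sigma_families S) [set i | i = fam_u \/ i = fam_vu].
have suvu : sub_sigma uvu by exact: sub_sigma_joinset sub_sigma_families.
have uvu_u : sigma_join (sigma_u S) `<=` uvu.
  by apply: (@joinset_sup _ _ _ (sigma_families S) _ fam_u); left.
have uvu_vu : sigma_join (sigma_vu S) `<=` uvu.
  by apply: (@joinset_sup _ _ _ (sigma_families S) _ fam_vu); right.
have sub2 J K : join2 (joinset (sigma_u S) J) (joinset (sigma_vu S) K) `<=` uvu.
  apply: join2_sub => //.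
    by apply: subset_trans uvu_u; exact: joinset_join.
  by apply: subset_trans uvu_vu; exact: joinset_join.
have sF := sub_sigma_fresh n; have sB := sub_sigma_before n.
have sO := sub_sigma_others.
have i2 : indep P (fresh n) (join2 (join2 (joinset (sigma_u S) (before n))
    (joinset (sigma_vu S) (before n))) others).
  apply: indep_joinr => //.
  apply: (sub_indep (F := uvu) (G := others)) => //.
    by apply: join2_sub => //; exact: sub2.
  apply: mutually_independent_indep (families_indep hstat) _.
    exact: sub_sigma_families.
  by apply/disj_setPS => i [/= [->|->]] [].
have sJ : sub_sigma (sigma_join (sigma_families S)).
  exact: sub_sigma_join sub_sigma_families.
have uJ : uvu `<=` sigma_join (sigma_families S) by exact: joinset_join.
apply: indep_joinr => //.
- exact: sub_sigma_join2.
- exact: sub_sigma_init.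
(* Everything joined so far is generated by the six families, which as a whole are independent of
   the initial estimates. *)
apply: (sub_indep (F := sigma_join (sigma_families S)) (G := sigma_init S)) => //.
  apply: join2_sub => //; first by apply: subset_trans uJ; exact: sub2.
  apply: join2_sub => //; first by apply: subset_trans uJ; exact: sub2.
  exact: joinset_join.
have s2 (i : 'I_2) :
    sub_sigma (tnth [tuple sigma_init S; sigma_join (sigma_families S)] i).
  by case: i => -[|[|//]] i2'; [exact: sub_sigma_init|].
exact: (@mutually_independent_pair _ _ _ _ _ _ (@Ordinal 2 1 isT) (@Ordinal 2 0 isT)
  s2 (winit_indep hstat) isT).
Qed.

Lemma others_past i n : i != fam_u -> i != fam_vu -> sigma_families S i `<=` past n.
Proof.
move=> iu ivu; apply: subset_trans (@join2_l _ _ _ _).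
apply: subset_trans (@join2_r _ _ _ _).
by apply: (@joinset_sup _ _ _ (sigma_families S) _ i); split.
Qed.

Lemma before_past n : join2 (joinset (sigma_u S) (before n))
    (joinset (sigma_vu S) (before n)) `<=` past n.
Proof.
apply: subset_trans (@join2_l _ _ _ _); exact: join2_l.
Qed.

Lemma past_le m n : (m <= n)%N -> past m `<=` past n.
Proof.
move=> mn; have sP := sub_sigma_past n.
have mnb (I : Type) : (before m : set (I * nat)) `<=` before n.
  by move=> x /= xm; exact: leq_trans xm mn.
apply: join2_sub => //; last exact: join2_r.
apply: join2_sub => //; last first.
  by apply: subset_trans (@join2_l _ _ _ _); exact: join2_r.
apply: subset_trans (@before_past n).
apply: join2_sub; first exact: sub_sigma_before.
  by apply: subset_trans (@join2_l _ _ _ _); exact: sub_joinset.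
by apply: subset_trans (@join2_r _ _ _ _); exact: sub_joinset.
Qed.

Lemma mxmeas_past_u k i n : (i < n)%N -> mxmeas (past n) (u S k i).
Proof.
move=> lin; apply: sub_mxmeas (mxmeas_u k i).
apply: subset_trans (@before_past n); apply: subset_trans (@join2_l _ _ _ _).
exact: joinset_sup.
Qed.

Lemma mxmeas_past_vu l k i n : (i < n)%N -> mxmeas (past n) (vu S l k i).
Proof.
move=> lin; apply: sub_mxmeas (mxmeas_vu l k i).
apply: subset_trans (@before_past n); apply: subset_trans (@join2_r _ _ _ _).
exact: joinset_sup.
Qed.

Lemma mxmeas_past_v k i n : mxmeas (past n) (v S k i).
Proof. by apply: sub_mxmeas (mxmeas_v k i); exact: others_past. Qed.

Lemma mxmeas_past_vw l k i n : mxmeas (past n) (vw S l k i).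
Proof. by apply: sub_mxmeas (mxmeas_vw l k i); exact: others_past. Qed.

Lemma mxmeas_past_vd l k i n : mxmeas (past n) (vd S l k i).
Proof. by apply: sub_mxmeas (mxmeas_vd l k i); exact: others_past. Qed.

Lemma mxmeas_past_vpsi l k i n : mxmeas (past n) (vpsi S l k i).
Proof. by apply: sub_mxmeas (mxmeas_vpsi l k i); exact: others_past. Qed.

Lemma mxmeas_past_winit k n : mxmeas (past n) (winit S k).
Proof.
apply: sub_mxmeas (mxmeas_sigma_mx (winit_L1 hstat k)).
apply: subset_trans (@join2_r _ _ _ _).
exact: (@sigma_join_sup _ _ _ (fun k => sigma_mx (winit S k))).
Qed.

Lemma mxmeas_fresh_u_link l k n : mxmeas (fresh n) (u_link S l k n).
Proof.
apply: mxmeasD; [apply: sub_mxmeas (mxmeas_u l n)|apply: sub_mxmeas (mxmeas_vu l k n)].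
  by apply: subset_trans (@join2_l _ _ _ _); exact: joinset_sup.
by apply: subset_trans (@join2_r _ _ _ _); exact: joinset_sup.
Qed.

Lemma mxmeas_phi_of (w : 'I_N -> T -> 'cV[R[i]]_M) k n :
  (forall l, mxmeas (past n) (w l)) -> mxmeas (past n) (phi_of S w k n).
Proof.
move=> mw; apply: mxmeas_sum => l _; apply: mxmeasZ.
by apply: mxmeasD => //; exact: mxmeas_past_vw.
Qed.

(** The update consumes u and vu at time n, which become past only at n.+1; this is the shift that
    makes the induction on [west] work. *)
Lemma mxmeas_psi_of (w : 'I_N -> T -> 'cV[R[i]]_M) k n :
  (forall l, mxmeas (past n) (w l)) -> mxmeas (past n.+1) (psi_of S w k n).
Proof.
move=> mw.
have mphi : mxmeas (past n.+1) (phi_of S w k n).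
  by apply: sub_mxmeas (mxmeas_phi_of k mw); exact: past_le.
have mul l : mxmeas (past n.+1) (u_link S l k n).
  by apply: mxmeasD; [exact: mxmeas_past_u|exact: mxmeas_past_vu].
apply: mxmeasD => //; apply: mxmeasZ; apply: mxmeas_sum => l _.
apply: mxmeasZ; apply: mxmeasM; first exact: mxmeas_adj.
apply: mxmeasB; last exact: mxmeasM.
apply: mxmeasD; last exact: mxmeas_past_vd.
apply: mxmeasD; last exact: mxmeas_past_v.
by apply: mxmeasM; [exact: mxmeas_past_u|exact: mxmeas_cst].
Qed.

Lemma mxmeas_west n k : mxmeas (past n) (west S n k).
Proof.
elim: n k => [|n IH] k; first exact: mxmeas_past_winit.
apply: mxmeas_sum => l _; apply: mxmeasZ; apply: mxmeasD.
  exact: mxmeas_psi_of.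
exact: mxmeas_past_vpsi.
Qed.

End SignalSigmas.

(** * The mean recursion *)

Section MeanRecursion.
Context (d : measure_display) (T : measurableType d) (R : realType).
Context (P : probability T R) (N M : nat) (S : diffusion T R N M).
Local Notation C := R[i].
Local Open Scope complex_scope.
Local Open Scope sesquilinear_scope.
Hypothesis hnet : network_ok S.
Hypothesis hstat : statistics_ok P S.

(** Signals of different families are independent at all times, so one zero mean is enough to cancel
    their correlation. *)
Lemma expMx_cross (i j : 'I_6) m n p (X : T -> 'M[C]_(m, n)) (Y : T -> 'M[C]_(m, p)) :
  i != j -> mxmeas (sigma_families S i) X -> mxmeas (sigma_families S j) Y ->
  LpMx P 1 X -> LpMx P 1 Y -> expMx P X = 0 \/ expMx P Y = 0 ->
  expMx P (fun t => (X t)^t* *m Y t) = 0.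
Proof.
move=> ij mX mY lX lY E0.
rewrite (expMxM (sub_sigma_families hstat i) (sub_sigma_families hstat j)
  (indep_families hstat ij) (mxmeas_adj mX) mY (LpMx_adj lX) lY).2.
rewrite expMx_adj //.
by case: E0 => ->; rewrite ?mulmx0 // trmx0 map_mx0 mul0mx.
Qed.

Lemma u_link_L2 l k i : LpMx P 2%:E (u_link S l k i).
Proof. by apply: LpMx2D; [exact: u_L2 hstat _ _|exact: vu_L2 hstat _ _ _]. Qed.

Lemma u_link_adj_L2 l k i : LpMx P 2%:E (fun t => (u_link S l k i t)^t*).
Proof. exact/LpMx_adj/u_link_L2. Qed.

Lemma expMx_u_link_mul m (Y : T -> 'M[C]_(1, m)) l k i : LpMx P 2%:E Y ->
  expMx P (fun t => (u_link S l k i t)^t* *m Y t) =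
  expMx P (fun t => (u S l i t)^t* *m Y t) +
  expMx P (fun t => (vu S l k i t)^t* *m Y t).
Proof.
move=> lY.
have -> : (fun t => (u_link S l k i t)^t* *m Y t) =
    (fun t => (u S l i t)^t* *m Y t + (vu S l k i t)^t* *m Y t).
  by apply/funext => t; rewrite /u_link raddfD /= map_mxD mulmxDl.
by rewrite expMxD //; apply: LpMx2M => //; apply: LpMx_adj;
  [exact: u_L2 hstat _ _|exact: vu_L2 hstat _ _ _].
Qed.

Lemma expMx_u_link_u l k i :
  expMx P (fun t => (u_link S l k i t)^t* *m u S l i t) = Ru S l.
Proof.
have lu := u_L2 hstat l i; have lvu := vu_L2 hstat l k i.
rewrite expMx_u_link_mul // (u_cov hstat).
rewrite (@expMx_cross fam_vu fam_u) ?addr0 //; try exact: LpMx12.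
- exact: mxmeas_fvu hstat _ _ _.
- exact: mxmeas_fu hstat _ _.
- by left; exact: vu_mean hstat _ _ _.
Qed.

Lemma expMx_u_link_vu l k i :
  expMx P (fun t => (u_link S l k i t)^t* *m vu S l k i t) = Rvu S l k.
Proof.
have lu := u_L2 hstat l i; have lvu := vu_L2 hstat l k i.
rewrite expMx_u_link_mul // (vu_cov hstat).
rewrite (@expMx_cross fam_u fam_vu) ?add0r //; try exact: LpMx12.
- exact: mxmeas_fu hstat _ _.
- exact: mxmeas_fvu hstat _ _ _.
- by left; exact: u_mean hstat _ _.
Qed.

Lemma expMx_u_link_u_link l k i :
  expMx P (fun t => (u_link S l k i t)^t* *m u_link S l k i t) =
  Ru S l + Rvu S l k.
Proof.
rewrite -(expMx_u_link_u l k i) -(expMx_u_link_vu l k i) -expMxD.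
- by congr (expMx P _); apply/funext => t; rewrite -mulmxDr.
- by apply: LpMx2M; [exact: u_link_adj_L2|exact: u_L2 hstat _ _].
- by apply: LpMx2M; [exact: u_link_adj_L2|exact: vu_L2 hstat _ _ _].
Qed.

Lemma expMx_u_link_v l k m i :
  expMx P (fun t => (u_link S l k i t)^t* *m v S m i t) = 0.
Proof.
have lv := v_L2 hstat m i.
rewrite expMx_u_link_mul //.
rewrite (@expMx_cross fam_u fam_v) ?(@expMx_cross fam_vu fam_v) ?addr0 //;
  try exact: LpMx12.
- exact: mxmeas_fvu hstat _ _ _.
- exact: mxmeas_v hstat _ _.
- exact: LpMx12 (vu_L2 hstat _ _ _).
- by right; exact: v_mean hstat _ _.
- exact: mxmeas_fu hstat _ _.
- exact: mxmeas_v hstat _ _.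
- exact: LpMx12 (u_L2 hstat _ _).
- by right; exact: v_mean hstat _ _.
Qed.

Lemma expMx_u_link_vd l k i :
  expMx P (fun t => (u_link S l k i t)^t* *m vd S l k i t) = 0.
Proof.
have lv := vd_L2 hstat l k i.
rewrite expMx_u_link_mul //.
rewrite (@expMx_cross fam_u fam_vd) ?(@expMx_cross fam_vu fam_vd) ?addr0 //;
  try exact: LpMx12.
- exact: mxmeas_fvu hstat _ _ _.
- exact: mxmeas_vd hstat _ _ _.
- exact: LpMx12 (vu_L2 hstat _ _ _).
- by right; exact: vd_mean hstat _ _ _.
- exact: mxmeas_fu hstat _ _.
- exact: mxmeas_vd hstat _ _ _.
- exact: LpMx12 (u_L2 hstat _ _).
- by right; exact: vd_mean hstat _ _ _.
Qed.

Lemma u_link_v_L1 l k m i :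
  LpMx P 1 (fun t => (u_link S l k i t)^t* *m v S m i t).
Proof. by apply: LpMx2M; [exact: u_link_adj_L2|exact: v_L2 hstat _ _]. Qed.

Lemma u_link_vd_L1 l k i :
  LpMx P 1 (fun t => (u_link S l k i t)^t* *m vd S l k i t).
Proof. by apply: LpMx2M; [exact: u_link_adj_L2|exact: vd_L2 hstat _ _ _]. Qed.

Lemma u_link_vu_L1 l k i :
  LpMx P 1 (fun t => (u_link S l k i t)^t* *m vu S l k i t).
Proof. by apply: LpMx2M; [exact: u_link_adj_L2|exact: vu_L2 hstat _ _ _]. Qed.

Lemma u_link_u_L1 l k i :
  LpMx P 1 (fun t => (u_link S l k i t)^t* *m u S l i t).
Proof. by apply: LpMx2M; [exact: u_link_adj_L2|exact: u_L2 hstat _ _]. Qed.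

Lemma u_link_u_link_L1 l k i :
  LpMx P 1 (fun t => (u_link S l k i t)^t* *m u_link S l k i t).
Proof. by apply: LpMx2M; [exact: u_link_adj_L2|exact: u_link_L2]. Qed.

Lemma Rvu_diag k : Rvu S k k = 0.
Proof. by have [] := link_cov0 hstat (l := k) (k := k) ltac:(by rewrite eqxx orbT). Qed.

(** Among the terms of v_link only vu correlates with u_link; it is the source of the bias. For l =
    k that term is absent, and the formula persists because Rvu vanishes on the diagonal. *)
Lemma u_link_v_link l k i :
  LpMx P 1 (fun t => (u_link S l k i t)^t* *m v_link S l k i t) /\
  expMx P (fun t => (u_link S l k i t)^t* *m v_link S l k i t) =
  - (Rvu S l k *m wo S).
Proof.
have lv := u_link_v_L1 l k l i; have ld := u_link_vd_L1 l k i.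
have lu := LpMx1_mulr (wo S) (u_link_vu_L1 l k i).
have [<-|lk] := eqVneq l k.
  have -> : v_link S l l i = v S l i.
    by apply/funext => t; rewrite /v_link eqxx.
  rewrite Rvu_diag mul0mx oppr0; split; first exact: u_link_v_L1.
  exact: expMx_u_link_v.
have -> : (fun t => (u_link S l k i t)^t* *m v_link S l k i t) =
    (fun t => ((u_link S l k i t)^t* *m v S l i t +
      (u_link S l k i t)^t* *m vd S l k i t) -
      ((u_link S l k i t)^t* *m vu S l k i t) *m wo S).
  apply/funext => t; rewrite /v_link (negPf lk).
  by rewrite mulmxBr mulmxDr mulmxA.
split; first by apply: LpMx1B => //; exact: LpMx1D.
rewrite expMxB //; last exact: LpMx1D.
rewrite expMxD // expMx_u_link_v expMx_u_link_vd expMx_mulr; last exact: u_link_vu_L1.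
by rewrite expMx_u_link_vu !add0r.
Qed.

Lemma LpMx_blockcol p (X : 'I_N -> T -> 'cV[C]_M) : (forall k, LpMx P p (X k)) ->
  LpMx P p (fun t => blockcol (fun k => X k t)).
Proof.
move=> lX r j; rewrite -/(LpC P p (fun t => blockcol (fun k => X k t) r j)).
by under eq_fun do rewrite mxE; exact: lX.
Qed.

Lemma expMx_blockcol (X : 'I_N -> T -> 'cV[C]_M) k :
  blk (expMx P (fun t => blockcol (fun k => X k t))) k = expMx P (X k).
Proof.
apply/colP => j; rewrite mxE !expMxE; congr (expC P _); apply/funext => t.
by rewrite mxE mxtens_indexK.
Qed.

Lemma blk_zmean k :
  blk (zmean S) k = - \sum_l (Cw S l k)%:C *: (Rvu S l k *m wo S).
Proof.
rewrite /zmean blkN blk_blockmx; congr (- _); apply: eq_bigr => l _.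
by rewrite blk_const_tens scalemxAl.
Qed.

(** Turns sums over neighborhoods into sums over all nodes, the form in which the block matrices
    act. *)
Lemma sum_nbh (V : lmodType C) (A : 'M[R]_N) k (F : 'I_N -> V) :
  (forall l k, l \notin nbh S k -> A l k = 0) ->
  \sum_(l in nbh S k) (A l k)%:C *: F l = \sum_l (A l k)%:C *: F l.
Proof.
move=> A0; rewrite big_mkcond; apply: eq_bigr => l _.
by case: ifPn => // /A0 ->; rewrite rmorph0 scale0r.
Qed.

Lemma z_node_mean k i : LpMx P 1 (z_node S k i) /\
  expMx P (z_node S k i) = blk (zmean S) k.
Proof.
have lz l : LpMx P 1 (fun t => (Cw S l k)%:C *:
    ((u_link S l k i t)^t* *m v_link S l k i t)).
  by apply: LpMx1Z; case: (u_link_v_link l k i).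
split; first by apply: LpMx1_sum.
rewrite expMx_sum // blk_zmean -(sum_nbh _ _ (Cw_supp hnet)) -sumrN.
apply: eq_bigr => l _; have [l1 l2] := u_link_v_link l k i.
by rewrite expMxZ // l2 scalerN.
Qed.

Lemma znet_mean i : LpMx P 1 (znet S i) /\ expMx P (znet S i) = zmean S.
Proof.
split; first by apply: LpMx_blockcol => k; case: (z_node_mean k i).
by apply: blkP => k; rewrite expMx_blockcol; case: (z_node_mean k i).
Qed.

Lemma phi_mean (w : 'I_N -> T -> 'cV[C]_M) k i : (forall l, LpMx P 1 (w l)) ->
  LpMx P 1 (phi_of S w k i) /\
  expMx P (phi_of S w k i) = \sum_l (A1 S l k)%:C *: expMx P (w l).
Proof.
move=> lw; have lvw l := LpMx12 (vw_L2 hstat l k i).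
have lwv l : LpMx P 1 (fun t => w l t + vw S l k i t) by exact: LpMx1D.
split; first by apply: LpMx1_sum => l _; exact: LpMx1Z.
rewrite expMx_sum => [|l _]; last exact: LpMx1Z.
rewrite -(sum_nbh _ _ (A1_supp hnet)); apply: eq_bigr => l _.
by rewrite expMxZ // expMxD // (vw_mean hstat) addr0.
Qed.

(** In the mean, the correction from link l is Ru wo - (Ru + Rvu) E phi: the regressor noise enters
    the quadratic term but not the correlation with the data. *)
Lemma psi_mean i k : (forall l, LpMx P 1 (west S i l)) ->
  LpMx P 1 (psi_of S (west S i) k i) /\
  wo S - expMx P (psi_of S (west S i) k i) =
  stepblk S k *m (wo S - expMx P (phi_of S (west S i) k i)) -
  (mu S k)%:C *: blk (zmean S) k.
Proof.
move=> lw; have [lphi _] := phi_mean k i lw.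
set phi := phi_of S (west S i) k i in lphi *.
have mphi : mxmeas (past S i) phi.
  by apply: (mxmeas_phi_of hstat) => l; exact: (mxmeas_west hstat).
(* Here the present separates from the past: u_link^* u_link is fresh at time i, whereas phi belongs
   to the past. *)
have UUphi l : LpMx P 1 (fun t => (u_link S l k i t)^t* *m u_link S l k i t *m phi t)
    /\ expMx P (fun t => (u_link S l k i t)^t* *m u_link S l k i t *m phi t) =
    (Ru S l + Rvu S l k) *m expMx P phi.
  rewrite -(expMx_u_link_u_link l k i).
  apply: (expMxM (sub_sigma_fresh hstat i) (sub_sigma_past hstat i)
    (fresh_past_indep hstat (n := i)) _ mphi _ lphi).
  - by apply: mxmeasM; [apply: mxmeas_adj|]; exact: (mxmeas_fresh_u_link hstat).
  - exact: u_link_u_link_L1.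
pose g l t := (u_link S l k i t)^t* *m
  (d_link S l k i t - u_link S l k i t *m phi t).
have gE l : g l = fun t => ((u_link S l k i t)^t* *m u S l i t) *m wo S +
    ((u_link S l k i t)^t* *m v S l i t + (u_link S l k i t)^t* *m vd S l k i t) -
    (u_link S l k i t)^t* *m u_link S l k i t *m phi t.
  apply/funext => t; rewrite /g /d_link /d_node mulmxBr mulmxDr mulmxDr !mulmxA.
  by rewrite addrA.
have lu l := LpMx1_mulr (wo S) (u_link_u_L1 l k i).
have lvv l := LpMx1D (u_link_v_L1 l k l i) (u_link_vd_L1 l k i).
have luvv l := LpMx1D (lu l) (lvv l).
have lg l : LpMx P 1 (g l).
  by rewrite gE; apply: LpMx1B => //; case: (UUphi l).
have Eg l : expMx P (g l) = Ru S l *m wo S - (Ru S l + Rvu S l k) *m expMx P phi.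
  rewrite gE expMxB //; last by case: (UUphi l).
  rewrite (UUphi l).2 expMxD // expMx_mulr; last exact: u_link_u_L1.
  rewrite expMx_u_link_u expMxD; [|exact: u_link_v_L1|exact: u_link_vd_L1].
  by rewrite expMx_u_link_v expMx_u_link_vd !addr0.
have lsum : LpMx P 1 (fun t => \sum_(l in nbh S k) (Cw S l k)%:C *: g l t).
  by apply: LpMx1_sum => l _; exact: LpMx1Z.
have -> : psi_of S (west S i) k i = (fun t => phi t +
    (mu S k)%:C *: \sum_(l in nbh S k) (Cw S l k)%:C *: g l t) by [].
clearbody g phi.
split; first by apply: LpMx1D => //; exact: LpMx1Z.
rewrite expMxD //; last exact: LpMx1Z.
rewrite expMxZ // expMx_sum => [|l _]; last exact: LpMx1Z.
under eq_bigr => l _ do rewrite expMxZ // Eg.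
rewrite blk_zmean /stepblk mulmxBl mul1mx mul_scalar_mx -scalemxAl.
rewrite opprD addrA -[RHS]addrA; congr (_ + _).
rewrite -opprD -scalerDr; congr (- (_ *: _)).
rewrite -(sum_nbh _ _ (Cw_supp hnet)) /Rprime_node mulmx_suml -sumrB.
(* Writing Ru wo as (Ru + Rvu) wo - Rvu wo separates the error term from the bias. *)
apply: eq_bigr => l _; rewrite -scalemxAl -scalerBr; congr (_ *: _).
by rewrite [in RHS]mulmxBr (mulmxDl _ _ (wo S)) addrAC addrK.
Qed.

Lemma west_L1 n k : LpMx P 1 (west S n k).
Proof.
elim: n k => [|n IH] k; first exact: winit_L1 hstat k.
apply: LpMx1_sum => l _; apply: LpMx1Z; apply: LpMx1D.
  by case: (psi_mean l IH).
exact: LpMx12 (vpsi_L2 hstat _ _ _).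
Qed.

Lemma west_mean n k : expMx P (west S n.+1 k) =
  \sum_l (A2 S l k)%:C *: expMx P (psi_of S (west S n) l n).
Proof.
have lpsi l := (psi_mean l (west_L1 n)).1.
have lv l := LpMx12 (vpsi_L2 hstat l k n).
rewrite expMx_sum => [|l _]; last by apply: LpMx1Z; exact: LpMx1D.
rewrite -(sum_nbh _ _ (A2_supp hnet)); apply: eq_bigr => l _.
rewrite expMxZ; last exact: LpMx1D.
by rewrite expMxD // (vpsi_mean hstat) addr0.
Qed.

Lemma werr_L1 n : LpMx P 1 (werr S n).
Proof.
apply: LpMx_blockcol => k; apply: LpMx1B; first exact: LpMx_cst.
exact: west_L1.
Qed.

Lemma blk_werr n k : blk (expMx P (werr S n)) k = wo S - expMx P (west S n k).
Proof.
rewrite expMx_blockcol expMxB ?expMx_cst //; first exact: LpMx_cst.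
exact: west_L1.
Qed.

(** Weights summing to 1 reproduce the constant vector, so recursions for estimates become
    recursions for errors. *)
Lemma stochastic_sub (A : 'M[R]_N) k (w : 'cV[C]_M) (x : 'I_N -> 'cV[C]_M) :
  A^T *m const_mx 1 = const_mx 1 :> 'cV_N ->
  w - \sum_l (A l k)%:C *: x l = \sum_l (A l k)%:C *: (w - x l).
Proof.
move=> A1; under [RHS]eq_bigr do rewrite scalerBr.
rewrite sumrB -scaler_suml -rmorph_sum; congr (_ - _).
have /colP/(_ k) := A1; rewrite !mxE.
under eq_bigr do rewrite !mxE mulr1.
by move=> ->; rewrite rmorph1 scale1r.
Qed.

Lemma werr_mean n : expMx P (werr S n.+1) =
  Bmx S *m expMx P (werr S n) - (A2net S)^T *m stepmx S *m zmean S.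
Proof.
apply: blkP => k; rewrite blk_werr west_mean.
rewrite (stochastic_sub _ _ _ (A2_sto hnet)).
rewrite blkD blkN /Bmx -!mulmxA !blk_tens -sumrB; apply: eq_bigr => l _.
rewrite -scalerBr; congr (_ *: _).
rewrite (psi_mean l (west_L1 n)).2 step_blockdiag !blk_blockdiag mul_scalar_mx.
congr (_ *m _ - _); rewrite blk_tens (phi_mean l n (west_L1 n)).2.
rewrite (stochastic_sub _ _ _ (A1_sto hnet)).
by apply: eq_bigr => m _; rewrite blk_werr.
Qed.

(** Symmetry is read off from the covariance as the mean of u^* u; the choice of time 0 is
    arbitrary. *)
Lemma Ru_herm l : (Ru S l)^t* = Ru S l.
Proof.
have lu := u_L2 hstat l 0%N; rewrite -(u_cov hstat l 0%N) -expMx_adj.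
  by congr (expMx P _); apply/funext => t; rewrite adjmxM trmxCK.
by apply: LpMx2M => //; exact: LpMx_adj.
Qed.

Lemma Rvu_herm l k : (Rvu S l k)^t* = Rvu S l k.
Proof.
have lu := vu_L2 hstat l k 0%N; rewrite -(vu_cov hstat l k 0%N) -expMx_adj.
  by congr (expMx P _); apply/funext => t; rewrite adjmxM trmxCK.
by apply: LpMx2M => //; exact: LpMx_adj.
Qed.

Lemma Ru_Rvu_herm k l : (Ru S l + Rvu S l k)^t* = Ru S l + Rvu S l k.
Proof. by rewrite raddfD /= map_mxD Ru_herm Rvu_herm. Qed.

Lemma Rprime_herm k : (Rprime_node S k)^t* = Rprime_node S k.
Proof.
rewrite /Rprime_node raddf_sum /= map_mx_sum; apply: eq_bigr => l _.
rewrite linearZ /= map_mxZ Ru_Rvu_herm; congr (_ *: _).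
exact: conjc_real.
Qed.

End MeanRecursion.

Theorem mainTheorem1 (d : measure_display) (T : measurableType d)
    (R : realType) (P : probability T R) (N M : nat) (S : diffusion T R N M)
    (hN : (0 < N)%N) (hM : (0 < M)%N)
    (hnet : network_ok S) (hstat : statistics_ok P S) :
  [/\ forall i, LpMx P 1 (znet S i) /\ expMx P (znet S i) = zmean S,
      (forall i, LpMx P 1 (werr S i)) /\
      (forall i, expMx P (werr S i.+1) =
         Bmx S *m expMx P (werr S i) - (A2net S)^T *m stepmx S *m zmean S),
      stable (1%:M - stepmx S *m Rprime S) -> stable (Bmx S),
      (forall k, posdefmx (Rprime_node S k)) ->
      (forall k, mu S k < 2 / lambda_max (Rprime_node S k)) ->
      mean_converges P S
    & (Cw S)^T *m const_mx 1 = const_mx 1 :> 'cV_N ->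
      (forall k, posdefmx (Rprime_node S k)) ->
      (forall k, mu S k <
         2 / \big[Num.max/0]_(l in nbh S k) lambda_max (Ru S l + Rvu S l k)) ->
      mean_converges P S].
Proof.
have hR := Rprime_herm hstat.
have rec := werr_mean hnet hstat.
split.
- by move=> i; exact: znet_mean.
- by split=> // i; exact: werr_L1.
- exact: stable_Bmx.
- move=> pdR hmu; have [c hc] := stepbound_lambda_max hM hnet pdR hmu.
  exact: (mean_error_cvg hnet hR (e := fun n => expMx P (werr S n)) hc rec).
- move=> C1 pdR hmu.
  have [c hc] := stepbound_doubly_stochastic hM hnet pdR C1 (Ru_Rvu_herm hstat) hmu.
  exact: (mean_error_cvg hnet hR (e := fun n => expMx P (werr S n)) hc rec).
Qed.
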